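(* Let $(\mathcal{U},f,\mathfrak{I})$ be a regular lemniscate region with $\mathfrak{I}=(a,b)$, and let $w(z)$ be an analytic function in $\mathcal{U}$. Then the function $$L_w(t)=\int_{E_{\mathcal{U},f}(t)}|w(z)|^2\,|dz|,\qquad t\in(a,b),$$ admits an analytic continuation $L_w(z)$ into the strip $\{z\in\mathbb{C}: a<\mathrm{Re}\,z<b\}$.
   Context: Let $f$ be an analytic function (on an open subset of $\mathbb{C}$) and, for real $t$, let $E_f(t)=\{z:\ln|f(z)|=t\}$. A lemniscate region of $f$ is a triple $(\mathcal{U},f,\mathfrak{I})$, where $\mathfrak{I}=(a,b)$ is an open interval ($-\infty\le a<b\le+\infty$), $\mathcal{U}$ is a connected component of the set $\{z: a<\ln|f(z)|<b\}$, and for every $t\in\mathfrak{I}$ the set $E_{\mathcal{U},f}(t):=E_f(t)\cap\mathcal{U}$ is compact; this is understood in the sense that the map $\ln|f|:\mathcal{U}\to\mathfrak{I}$ is proper. The lemniscate region is called regular if $f(z)f'(z)\neq0$ for all $z\in\mathcal{U}$. $|dz|$ denotes integration with respect to arc length. *)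

(* Defs.v *)
From HB Require Import structures.
From mathcomp Require Import all_boot all_order all_algebra.
From mathcomp Require Import complex.
From mathcomp Require Import all_classical all_reals all_analysis.

Set Implicit Arguments.
Unset Strict Implicit.
Unset Printing Implicit Defensive.

Import Order.TTheory GRing.Theory Num.Theory.
Import numFieldNormedType.Exports.
Local Open Scope classical_set_scope.
Local Open Scope ring_scope.

(* The alias [^o] gives R[i] its topology and its structure of normed module
   over itself, so that [derivable g z 1] and [derive1 g] below are the complex
   derivative. *)
Notation Cplx R := ((R[i])^o).

Section LemniscateRegion.
Variable R : realType.
Implicit Types (D U E : set (Cplx R)) (f g w : Cplx R -> Cplx R) (a b : \bar R).

Definition cmod (z : Cplx R) : R := ComplexField.Normc.normc z.

Definition analytic_on D g : Prop := forall z, D z -> derivable g z 1.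

(* [lne] is the extended logarithm, so this is -oo at the zeros of f (whereas
   the real-valued [ln] takes the value 0 at 0). *)
Definition lnmod f (z : Cplx R) : \bar R := lne (cmod (f z))%:E.

(* As functions are total, the open domain D of f is explicit. *)
Definition level_set D f (t : R) : set (Cplx R) :=
  D `&` [set z | lnmod f z = t%:E].

Definition level_band D f a b : set (Cplx R) :=
  D `&` [set z | (a < lnmod f z < b)%E].

Definition is_component U E : Prop :=
  exists2 z, E z & U = connected_component E z.

(* [lr_proper] is the properness of ln|f| : U -> (a, b); taking for K a
   singleton gives the compactness of the sets E_f(t) `&` U. *)
Record lemniscate_region D U f a b : Prop := LemniscateRegion {
  lr_open : open D ;
  lr_analytic : analytic_on D f ;
  lr_lt : (a < b)%E ;
  lr_component : is_component U (level_band D f a b) ;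
  lr_proper : forall K : set R, compact K ->
    K `<=` [set t | (a < t%:E < b)%E] ->
    compact (U `&` [set z | exists2 t, K t & lnmod f z = t%:E]) }.

Definition regular_lemniscate_region D U f a b : Prop :=
  lemniscate_region D U f a b /\ forall z, U z -> f z * derive1 f z != 0.

Definition speed (c : R -> Cplx R) (s : R) : R :=
  Num.sqrt (derive1 (fun u => complex.Re (c u)) s ^+ 2 +
            derive1 (fun u => complex.Im (c u)) s ^+ 2).

Record regular_closed_curve (c : R -> Cplx R) : Prop := RegularClosedCurve {
  rcc_Re_derivable : forall s, derivable (fun u => complex.Re (c u)) s 1 ;
  rcc_Im_derivable : forall s, derivable (fun u => complex.Im (c u)) s 1 ;
  rcc_Re_C1 : continuous (derive1 (fun u => complex.Re (c u))) ;
  rcc_Im_C1 : continuous (derive1 (fun u => complex.Im (c u))) ;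
  rcc_periodic : forall s, c (s + 1) = c s ;
  rcc_regular : forall s, speed c s != 0 }.

(* c describes E as a disjoint union of n simple closed C^1 curves, each
   traversed once as the parameter runs over [0, 1[. *)
Record parametrizes n (c : 'I_n -> R -> Cplx R) E : Prop := Parametrizes {
  par_curve : forall i, regular_closed_curve (c i) ;
  par_image : E = \bigcup_(i in [set: 'I_n]) range (c i) ;
  par_inj : forall i j s u, 0 <= s < 1 -> 0 <= u < 1 ->
    c i s = c j u -> i = j /\ s = u }.

(* The integral of h over E with respect to arc length is v: E is a finite
   disjoint union of simple closed C^1 curves, and v is the sum of the
   integrals h(c(s)) |c'(s)| ds for every parametrization of E by such. *)
Definition is_arclength_integral E (h : Cplx R -> R) (v : R) : Prop :=
  (exists n (c : 'I_n -> R -> Cplx R), parametrizes c E) /\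
  forall n (c : 'I_n -> R -> Cplx R), parametrizes c E ->
    v = \sum_(i < n)
          \int[lebesgue_measure]_(s in `[0, 1]) (h (c i s) * speed (c i) s).

Definition strip a b : set (Cplx R) :=
  [set z | (a < (complex.Re z)%:E < b)%E].

End LemniscateRegion.

(* Main.v *)
Require Import Defs.
From HB Require Import structures.
From mathcomp Require Import all_boot all_order all_algebra.
From mathcomp Require Import complex.
From mathcomp Require Import all_classical all_reals all_analysis.
From mathcomp Require Import ring lra.

(** The map f covers the annulus e^a < |z| < e^b properly and without
    critical points, so the region U is, like the annulus, a quotient of the
    strip a < Re z < b. Precisely, the exponential lifts through f to a
    holomorphic map g from the strip onto U, with f (g z) = exp z, which
    identifies two points exactly when they differ by a multiple of i T
    (lift_through, lift_surj, lift_period). The level set of level t is then the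
    single closed curve y |-> g (t + i y), 0 <= y < T, and
      L_w(t) = int_0^T |w (g (t + i y))|^2 |g' (t + i y)| dy.
    As g' has no zero on the strip, which is convex, g' = h^2 for a holomorphic h
    (lift_sqrt), and the integrand is |W (t + i y)|^2 with W = (w o g) h
    holomorphic on the strip. Since |W (t + i y)|^2 is the product of
    W (t + i y) with the conjugate of W (conj t + i y), it is the restriction to
    real t of
      L(z) = int_0^T W (z + i y) conj (W (conj z + i y)) dy,
    where the second factor is holomorphic in z as well, so that L can be
    differentiated under the integral sign (reflected_integral_derivable).

    Analytic means complex differentiable here, so that the regularity of
    holomorphic functions has to be established. Goursat's theorem on rectangles
    (goursat), read in the coordinate log (u - z), gives the mean value property
    on circles, including for functions that are only continuous at the centre
    (circle_mean). Applied to a difference quotient, it expresses F' as an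
    integral of F over a circle of fixed radius (cauchy_derivative), whence F'
    is continuous, then holomorphic (derive1_derivable).

    Both liftings are instances of one monodromy theorem over convex sets
    (lift_exists) for proper maps with local inverses: f over the exponential,
    properness being that of ln |f|, and squaring over g'.

    The arc length integral does not depend on the parametrization of the level
    set, because any regular closed curve c in it is g (t + i th s) for a
    function th that is obtained as a primitive of the imaginary part of
    (f o c)' / (f o c) (curve_lift, curve_value). *)

Import Order.TTheory GRing.Theory Num.Theory.
Import numFieldNormedType.Exports.
Local Open Scope classical_set_scope.
Local Open Scope ring_scope.

Set Implicit Arguments.
Unset Strict Implicit.
Unset Printing Implicit Defensive.

(** * Moduli, limits and compactness in the plane *)
Section ComplexPlane.
Variable R : realType.
Local Notation C := (Cplx R).
Local Notation Re := (@complex.Re R).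
Local Notation Im := (@complex.Im R).
Implicit Types (z u v : C) (x y e : R).

Definition rc x : C := real_complex R x.
Definition ic : C := Complex 0 1.

Lemma ReD z u : Re (z + u) = Re z + Re u. Proof. exact: raddfD. Qed.
Lemma ImD z u : Im (z + u) = Im z + Im u. Proof. exact: raddfD. Qed.
Lemma ReN z : Re (- z) = - Re z. Proof. by case: z. Qed.
Lemma ImN z : Im (- z) = - Im z. Proof. by case: z. Qed.
Lemma ReM z u : Re (z * u) = Re z * Re u - Im z * Im u.
Proof. by case: z; case: u. Qed.
Lemma ImM z u : Im (z * u) = Re z * Im u + Im z * Re u.
Proof. by case: z; case: u. Qed.
Lemma Re_rc x : Re (rc x) = x. Proof. by []. Qed.
Lemma Im_rc x : Im (rc x) = 0. Proof. by []. Qed.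
Lemma Re_ic : Re ic = 0. Proof. by []. Qed.
Lemma Im_ic : Im ic = 1. Proof. by []. Qed.
Definition ReImE := (ReD, ImD, ReN, ImN, ReM, ImM, Re_rc, Im_rc, Re_ic, Im_ic).

Lemma complex_ext z u : Re z = Re u -> Im z = Im u -> z = u.
Proof. by case: z => ? ?; case: u => ? ? /= -> ->. Qed.

Lemma ReIm z : z = rc (Re z) + ic * rc (Im z).
Proof. by apply: complex_ext; rewrite !ReImE; ring. Qed.

Lemma rcD x y : rc (x + y) = rc x + rc y. Proof. exact: rmorphD. Qed.
Lemma rcB x y : rc (x - y) = rc x - rc y. Proof. exact: rmorphB. Qed.
Lemma rcM x y : rc (x * y) = rc x * rc y. Proof. exact: rmorphM. Qed.
Lemma rc0 : rc 0 = 0. Proof. by []. Qed.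
Lemma rc1 : rc 1 = 1. Proof. by []. Qed.
Lemma rc_eq0 x : (rc x == 0) = (x == 0). Proof. exact: fmorph_eq0. Qed.
Lemma ic2 : ic * ic = -1. Proof. by apply: complex_ext; rewrite !ReImE /=; ring. Qed.
Lemma ic_neq0 : ic != 0. Proof. by rewrite eq_complex /= oner_eq0 andbF. Qed.

Lemma cmodE z : cmod z = Num.sqrt (Re z ^+ 2 + Im z ^+ 2).
Proof. by case: z. Qed.
Lemma normcE z : `|z| = rc (cmod z). Proof. by []. Qed.
Lemma cmod_ge0 z : 0 <= cmod z. Proof. by rewrite cmodE sqrtr_ge0. Qed.
Hint Resolve cmod_ge0 : core.
Lemma cmodM z u : cmod (z * u) = cmod z * cmod u.
Proof. exact: ComplexField.Normc.normcM. Qed.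
Lemma cmodV z : cmod z^-1 = (cmod z)^-1.
Proof. exact: ComplexField.Normc.normcV. Qed.
Lemma cmodD z u : cmod (z + u) <= cmod z + cmod u.
Proof. exact: le_normcD. Qed.
Lemma cmodN z : cmod (- z) = cmod z. Proof. exact: normcN. Qed.
Lemma cmodB z u : cmod (z - u) <= cmod z + cmod u.
Proof. by rewrite -(cmodN u) cmodD. Qed.
Lemma cmodC z u : cmod (z - u) = cmod (u - z).
Proof. by rewrite -cmodN opprB. Qed.
Lemma cmod0 : cmod (0 : C) = 0. Proof. exact: ComplexField.Normc.normc0. Qed.
Lemma cmod1 : cmod (1 : C) = 1. Proof. exact: ComplexField.Normc.normc1. Qed.
Lemma cmod_rc x : cmod (rc x) = `|x|.
Proof. by rewrite cmodE /= expr0n /= addr0 sqrtr_sqr. Qed.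
Lemma cmod_ic : cmod ic = 1.
Proof. by rewrite cmodE /= expr0n /= add0r expr1n sqrtr1. Qed.
Lemma cmod_eq0 z : (cmod z == 0) = (z == 0).
Proof.
apply/eqP/eqP => [|->]; last exact: cmod0.
exact: ComplexField.Normc.eq0_normc.
Qed.
Lemma cmod_gt0 z : (0 < cmod z) = (z != 0).
Proof. by rewrite lt_def cmod_ge0 andbT cmod_eq0. Qed.
Lemma cmodX z n : cmod (z ^+ n) = cmod z ^+ n.
Proof. by elim: n => [|n IH]; rewrite ?expr0 ?cmod1 // !exprS cmodM IH. Qed.
Lemma sqr_cmod z : cmod z ^+ 2 = Re z ^+ 2 + Im z ^+ 2.
Proof. by rewrite cmodE sqr_sqrtr // addr_ge0 // sqr_ge0. Qed.
Lemma cmod_triangle v z u : cmod (z - u) <= cmod (z - v) + cmod (v - u).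
Proof. by rewrite (_ : z - u = (z - v) + (v - u)) ?cmodD //; ring. Qed.
Lemma cmod_rev z u : cmod z - cmod u <= cmod (z - u).
Proof. by rewrite lerBlDr -{1}(subrK u z) cmodD. Qed.

Lemma Re_cmod z : `|Re z| <= cmod z.
Proof.
by rewrite -(ler_pXn2r (n := 2)) ?nnegrE // sqr_cmod real_normK ?num_real // lerDl sqr_ge0.
Qed.
Lemma Im_cmod z : `|Im z| <= cmod z.
Proof.
by rewrite -(ler_pXn2r (n := 2)) ?nnegrE // sqr_cmod real_normK ?num_real // lerDr sqr_ge0.
Qed.
Lemma cmod_ReIm z : cmod z <= `|Re z| + `|Im z|.
Proof. by rewrite {1}(ReIm z) (le_trans (cmodD _ _)) // cmodM cmod_ic mul1r !cmod_rc. Qed.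

Definition cconj z : C := conjc z.
Lemma Re_cconj z : Re (cconj z) = Re z. Proof. by case: z. Qed.
Lemma Im_cconj z : Im (cconj z) = - Im z. Proof. by case: z. Qed.
Lemma cconjM z u : cconj (z * u) = cconj z * cconj u.
Proof. by apply: complex_ext; rewrite ?(ReImE, Re_cconj, Im_cconj); ring. Qed.
Lemma cconjB z u : cconj (z - u) = cconj z - cconj u.
Proof. by apply: complex_ext; rewrite ?(ReImE, Re_cconj, Im_cconj); ring. Qed.
Lemma cconjK z : cconj (cconj z) = z.
Proof. by apply: complex_ext; rewrite ?(ReImE, Re_cconj, Im_cconj); ring. Qed.
Lemma cmod_conj z : cmod (cconj z) = cmod z.
Proof. by rewrite !cmodE Re_cconj Im_cconj sqrrN. Qed.
Lemma mul_conj z : z * cconj z = rc (cmod z ^+ 2).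
Proof. by apply: complex_ext; rewrite ?(ReImE, Re_cconj, Im_cconj) ?sqr_cmod; ring. Qed.

Lemma ltc_rc x y : (rc x < rc y :> R[i]) = (x < y).
Proof. exact: ltcR. Qed.

Lemma ltc_real (e : R[i]) : 0 < e -> e = rc (Re e) /\ 0 < Re e.
Proof. by case: e => x y; rewrite ltcE /= => /andP[/eqP -> ->]. Qed.

Lemma cvg_cmod (V : topologicalType) (f : V -> C) (x : V) z :
  f @ x --> z <-> forall e, 0 < e -> \forall t \near x, cmod (f t - z) < e.
Proof.
split=> [/cvgrPdist_lt H e e0|H].
  have e0' : 0 < (rc e : R[i]) by rewrite (ltc_rc 0).
  by apply: filterS (H _ e0') => t; rewrite normcE ltc_rc cmodC.
apply/cvgrPdist_lt => e /ltc_real[eE e0'].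
by apply: filterS (H _ e0') => t; rewrite normcE eE ltc_rc cmodC.
Qed.

Lemma nbhs_cmod z (A : set C) :
  nbhs z A <-> exists2 e, 0 < e & forall u, cmod (u - z) < e -> A u.
Proof.
split=> [/nbhs_ballP[e /= /ltc_real[eE e0] H]|[e e0 H]].
  exists (Re e) => // u h; apply: H.
  by rewrite -ball_normE /= normcE eE ltc_rc cmodC.
apply/nbhs_ballP; exists (rc e); first by rewrite /= (ltc_rc 0).
move=> u; rewrite -ball_normE /= normcE ltc_rc cmodC; exact: H.
Qed.

Lemma near_cmod z e : 0 < e -> \forall u \near z, cmod (u - z) < e.
Proof. by move=> e0; apply/nbhs_cmod; exists e. Qed.

Lemma nbhs_real x (A : set R) :
  nbhs x A <-> exists2 e, 0 < e & forall y, `|y - x| < e -> A y.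
Proof.
split=> [/nbhs_ballP[e /= e0 H]|[e e0 H]].
  by exists e => // u h; apply: H; rewrite -ball_normE /= distrC.
apply/nbhs_ballP; exists e => // u; rewrite -ball_normE /= distrC; exact: H.
Qed.

Section CvgAt.
Variables (V : topologicalType) (x : V).
Implicit Types f g : V -> C.

(* The limit rules at the type C, at a point x, in a form that composes as
   terms: atM (at_cst k) cf is the limit of k * f. *)
Lemma at_near f g z : (\forall y \near x, f y = g y) -> f @ x --> z -> g @ x --> z.
Proof. by move=> fg; apply: cvg_trans; apply: near_eq_cvg. Qed.

Lemma atD f g z u : f @ x --> z -> g @ x --> u -> (fun t => f t + g t) @ x --> z + u.
Proof. by move=> cf cg; exact: (cvgD cf cg). Qed.

Lemma atN f z : f @ x --> z -> (fun t => - f t) @ x --> - z.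
Proof. by move=> cf; exact: (cvgN cf). Qed.

Lemma atB f g z u : f @ x --> z -> g @ x --> u -> (fun t => f t - g t) @ x --> z - u.
Proof. by move=> cf cg; exact: (atD cf (atN cg)). Qed.

Lemma atM f g z u : f @ x --> z -> g @ x --> u -> (fun t => f t * g t) @ x --> z * u.
Proof. by move=> cf cg; exact: (cvgM cf cg). Qed.

Lemma atV f z : z != 0 -> f @ x --> z -> (fun t => (f t)^-1) @ x --> z^-1.
Proof. by move=> z0 cf; exact: (cvgV z0 cf). Qed.

Lemma at_cst z : (fun=> z) @ x --> z.
Proof. exact: cvg_cst. Qed.

Lemma at_Re f z : f @ x --> z -> (fun t => Re (f t)) @ x --> Re z.
Proof.
move=> /cvg_cmod H; apply/cvgrPdist_lt => e e0.
apply: filterS (H _ e0) => t; apply: le_lt_trans.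
by rewrite cmodC -ReN -ReD Re_cmod.
Qed.

Lemma at_Im f z : f @ x --> z -> (fun t => Im (f t)) @ x --> Im z.
Proof.
move=> /cvg_cmod H; apply/cvgrPdist_lt => e e0.
apply: filterS (H _ e0) => t; apply: le_lt_trans.
by rewrite cmodC -ImN -ImD Im_cmod.
Qed.

Lemma at_rc (f : V -> R) (y : R) : f @ x --> y -> (fun t => rc (f t)) @ x --> rc y.
Proof.
move=> /cvgrPdist_lt H; apply/cvg_cmod => e e0.
by apply: filterS (H _ e0) => t; rewrite -rcB cmod_rc distrC.
Qed.

Lemma at_ReIm f z : (fun t => Re (f t)) @ x --> Re z ->
  (fun t => Im (f t)) @ x --> Im z -> f @ x --> z.
Proof.
move=> H1 H2; rewrite (ReIm z) (_ : f = fun t => rc (Re (f t)) + ic * rc (Im (f t))).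
  exact (atD (at_rc H1) (atM (@at_cst ic) (at_rc H2))).
by apply/funext => t; exact: ReIm.
Qed.

Lemma at_conj f z : f @ x --> z -> (fun t => cconj (f t)) @ x --> cconj z.
Proof.
move=> /cvg_cmod H; apply/cvg_cmod => e e0.
by apply: filterS (H _ e0) => t; rewrite -cconjB cmod_conj.
Qed.

Lemma at_cmod f z : f @ x --> z -> (fun t => cmod (f t)) @ x --> cmod z.
Proof.
move=> /cvg_cmod H; apply/cvgrPdist_lt => e e0.
apply: filterS (H _ e0) => t; apply: le_lt_trans.
by rewrite ler_norml cmodC cmod_rev andbT cmodC lerNl opprB cmod_rev.
Qed.

Lemma at_comp (W : topologicalType) (F : W -> C) (h : V -> W) (y : W) z :
  h @ x --> y -> F @ y --> z -> (fun t => F (h t)) @ x --> z.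
Proof. by move=> c1 c2; exact: (cvg_comp _ _ c1 c2). Qed.

End CvgAt.

(** Compactness is used in what follows through cluster points of sequences only. *)
Lemma cluster_seq (T : topologicalType) (K : set T) (u : nat -> T) :
  compact K -> (forall n, K (u n)) ->
  exists2 p, K p & forall A, nbhs p A -> forall N, exists2 n, (N <= n)%N & A (u n).
Proof.
move=> cK Ku; have [|p [Kp clp]] := cK (u @ \oo) _.
  by exists 0%N => // n _; exact: Ku.
exists p => // A Ap N.
have [|x [[n /= Nn <-] An]] := clp [set u n | n in [set n | (N <= n)%N]] A _ Ap.
  by exists N => // n Nn; exists n.
by exists n.
Qed.

(** Bolzano-Weierstrass in the plane, from the compactness of a square. *)
Lemma bounded_cluster (u : nat -> C) M : (forall n, cmod (u n) <= M) ->
  exists p, forall e, 0 < e -> forall N, exists2 n, (N <= n)%N & cmod (u n - p) < e.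
Proof.
move=> uM; pose K := (`[-M, M] `*` `[-M, M])%classic : set (R * R).
have cK : compact K by apply: compact_setX; exact: segment_compact.
have [|p Kp H] := cluster_seq (u := fun n => (Re (u n), Im (u n))) cK.
  move=> n; split => /=; rewrite in_itv /= -ler_norml.
    exact: le_trans (Re_cmod _) (uM n).
  exact: le_trans (Im_cmod _) (uM n).
exists (Complex p.1 p.2) => e e0 N.
have e2 : 0 < e / 2 by rewrite divr_gt0.
have [|n Nn [/= h1 h2]] := H (ball p.1 (e/2) `*` ball p.2 (e/2)) _ N.
  by exists (ball p.1 (e/2), ball p.2 (e/2)) => //=; split; exact: nbhsx_ballx.
exists n => //; apply: le_lt_trans (cmod_ReIm _) _; rewrite !ReImE /=.
rewrite [ltRHS]splitr; apply: ltrD.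
  by move: h1; rewrite -ball_normE /= distrC.
by move: h2; rewrite -ball_normE /= distrC.
Qed.

End ComplexPlane.
Arguments at_cst {R V x} z.
#[export] Hint Resolve cmod_ge0 : core.

(** * Derivatives of complex-valued functions *)
Section Derivatives.
Variable R : realType.
Local Notation C := (Cplx R).
Local Notation Re := (@complex.Re R).
Local Notation Im := (@complex.Im R).
Local Notation rc := (@rc R).
Local Notation ic := (@ic R).

(** Caratheodory's form of differentiability: f y - f x is the increment of e
    times a factor that is continuous at x, and l is the value of this factor
    at x. With e the identity this is complex differentiability, with e the
    embedding of the real line it is the derivative of a curve, so the two share
    their calculus, and the chain rule mixing them is a product of factors. *)
Definition hasder (V : topologicalType) (e : V -> C) (f : V -> C) (x : V) (l : C) :=
  exists2 phi : V -> C, phi @ x --> l &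
    phi x = l /\ \forall y \near x, f y - f x = phi y * (e y - e x).

Definition cder (f : C -> C) z l := hasder (id : C -> C) f z l.
Definition rder (c : R -> C) s l := hasder rc c s l.

Section General.
Variables (V : topologicalType) (e : V -> C).
Implicit Types (f g : V -> C) (x : V) (l m : C).

Lemma der_near f g x l : (\forall y \near x, f y = g y) ->
  hasder e f x l -> hasder e g x l.
Proof.
move=> fg [phi cphi [phix dphi]]; exists phi => //; split=> //.
by near=> y; rewrite -(nbhs_singleton fg) -(near fg y) //; near: y.
Unshelve. all: by end_near. Qed.

Lemma der_ext f g x l : f =1 g -> hasder e f x l -> hasder e g x l.
Proof. by move=> fg; apply: der_near; near=> y; exact: fg.
Unshelve. all: by end_near. Qed.

Lemma der_eq f x l m : hasder e f x l -> l = m -> hasder e f x m.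
Proof. by move=> ? <-. Qed.

Lemma der_cst (k : C) x : hasder e (fun=> k) x 0.
Proof.
exists (fun=> 0); first exact: at_cst.
by split=> //; near=> y; rewrite subrr mul0r.
Unshelve. all: by end_near. Qed.

Lemma der_base x : hasder e e x 1.
Proof.
exists (fun=> 1); first exact: at_cst.
by split=> //; near=> y; rewrite mul1r.
Unshelve. all: by end_near. Qed.

Lemma derD f g x l m : hasder e f x l -> hasder e g x m ->
  hasder e (fun y => f y + g y) x (l + m).
Proof.
move=> [p cp [px dp]] [q cq [qx dq]].
exists (fun y => p y + q y); first exact: (atD cp cq).
split; first by rewrite px qx.
near=> y; rewrite opprD addrACA (near dp y) ?(near dq y) ?mulrDl //; near: y; assumption.
Unshelve. all: by end_near. Qed.

Lemma derN f x l : hasder e f x l -> hasder e (fun y => - f y) x (- l).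
Proof.
move=> [p cp [px dp]]; exists (fun y => - p y); first exact: (atN cp).
split; first by rewrite px.
near=> y; rewrite -opprD (near dp y) ?mulNr //; near: y; assumption.
Unshelve. all: by end_near. Qed.

Lemma derB f g x l m : hasder e f x l -> hasder e g x m ->
  hasder e (fun y => f y - g y) x (l - m).
Proof. by move=> df /derN; exact: derD. Qed.

Hypothesis e_cont : continuous e.

Lemma der_cvg f x l : hasder e f x l -> f @ x --> f x.
Proof.
move=> [p cp [px dp]].
have -> : f x = l * (e x - e x) + f x by rewrite subrr mulr0 add0r.
have H : (fun y => p y * (e y - e x) + f x) @ x --> l * (e x - e x) + f x.
  apply: (atD _ (at_cst _)).
  exact: (atM cp (atB (@e_cont x) (at_cst _))).
apply: cvg_trans H; apply: near_eq_cvg.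
by near=> y; rewrite -(near dp y) ?subrK //; near: y.
Unshelve. all: by end_near. Qed.

Lemma derM f g x l m : hasder e f x l -> hasder e g x m ->
  hasder e (fun y => f y * g y) x (l * g x + f x * m).
Proof.
move=> df dg; have := der_cvg df; have := der_cvg dg.
move: df dg => [p cp [px dp]] [q cq [qx dq]] cg cf.
exists (fun y => p y * g y + f x * q y).
  exact: (atD (atM cp cg) (atM (at_cst _) cq)).
split; first by rewrite px qx.
near=> y.
have -> : f y * g y - f x * g x = (f y - f x) * g y + f x * (g y - g x) by ring.
have E1 : f y - f x = p y * (e y - e x) by near: y.
have E2 : g y - g x = q y * (e y - e x) by near: y.
rewrite E1 E2; ring.
Unshelve. all: by end_near. Qed.

Lemma der_comp (F : C -> C) f x l m : cder F (f x) m -> hasder e f x l ->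
  hasder e (fun y => F (f y)) x (m * l).
Proof.
move=> [q cq [qx dq]] df; have cf := der_cvg df; move: df => [p cp [px dp]].
exists (fun y => q (f y) * p y).
  exact: (atM (cvg_comp _ _ cf cq) cp).
split; first by rewrite px qx.
near=> y.
have E1 : f y - f x = p y * (e y - e x) by near: y.
by rewrite -mulrA -E1; near: y; exact: (cf _ dq).
Unshelve. all: by end_near. Qed.

End General.

Lemma id_continuous : continuous (id : C -> C). Proof. by move=> ?. Qed.
Lemma rc_continuous : continuous rc.
Proof. by move=> x; apply: at_rc; exact: cvg_id. Qed.

Definition cder_cvg := der_cvg id_continuous.
Definition rder_cvg := der_cvg rc_continuous.
Definition cderM := derM id_continuous.
Definition rderM := derM rc_continuous.
Lemma cder_comp (F f : C -> C) (z l m : C) :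
  cder F (f z) m -> cder f z l -> cder (fun y => F (f y)) z (m * l).
Proof. exact: (der_comp id_continuous). Qed.
Lemma rder_comp (F : C -> C) (f : R -> C) (s : R) (l m : C) :
  cder F (f s) m -> rder f s l -> rder (fun y => F (f y)) s (m * l).
Proof. exact: (der_comp rc_continuous). Qed.

Lemma cder_id (z : C) : cder id z 1.
Proof. exact: (der_base id). Qed.

Lemma rder_line (z u : C) (s : R) : rder (fun s => z + rc s * u) s u.
Proof.
apply: der_eq; first apply: derD; first exact: der_cst.
  apply: (rderM (der_base rc s)); exact: der_cst.
by rewrite add0r mul1r mulr0 addr0.
Qed.

Lemma cder_inv (z : C) : z != 0 -> cder (fun u => u^-1) z (- (z ^- 2)).
Proof.
move=> z0; exists (fun u => - (u^-1 * z^-1)).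
  have cV : (fun u : C => u^-1) @ z --> z^-1 .
    have cid : (fun u : C => u) @ z --> z by exact: cvg_id.
    exact (atV z0 cid).
  by rewrite -exprVn expr2; exact: (atN (atM cV (at_cst _))).
split; first by rewrite -exprVn expr2.
have z0' : 0 < cmod z by rewrite cmod_gt0.
near=> u; have u0 : u != 0.
  rewrite -cmod_gt0 -subr_gt0; have : cmod (u - z) < cmod z by near: u; exact: near_cmod.
  have := cmod_rev z u; rewrite cmodC; lra.
by field; rewrite z0 u0.
Unshelve. all: by end_near. Qed.

(** The factor is the difference quotient, continued by l. *)
Lemma hasder_limit (K : numFieldType) (f : K -> K) (z l : K) :
  (exists2 phi : K -> K, phi @ z --> l &
    phi z = l /\ \forall y \near z, f y - f z = phi y * (y - z)) <->
  (h^-1 *: (f (h *: 1 + z) - f z) @[h --> 0^'] --> l).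
Proof.
split=> [[phi cphi [phiz dphi]]|H].
  have F1 : phi (y + z) @[y --> 0^'] --> l.
    rewrite -phiz; apply/continuous_withinNshiftx.
    by rewrite /prop_for /continuous_at phiz.
  apply: cvg_trans F1; apply: near_eq_cvg.
  have H0 : \forall y \near 0^', f (y + z) - f z = phi (y + z) * y.
    apply: nbhs_dnbhs.
    have sz : (fun y : K => y + z) @ 0 --> z.
      have cid : (fun y : K => y) @ (0 : K) --> (0 : K) by exact: cvg_id.
      have cc : (fun _ : K => z) @ (0 : K) --> z by exact (@cvg_cst _ _ _ _ (nbhs_filter (0 : K))).
      have H0 := cvgD cid cc; rewrite add0r in H0; exact (H0 (nbhs_filter (0 : K))).
    apply: (@filterS _ (nbhs (0 : K)) (nbhs_filter (0 : K)) _ _ _ (sz _ dphi)) => y /=.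
    by rewrite addrK.
  near=> y.
  have E0 : f (y + z) - f z = phi (y + z) * y by near: y.
  rewrite [_%:A]mulr1 E0.
  have y0 : y != 0 by near: y; exact: nbhs_dnbhs_neq.
  by rewrite [RHS]mulrC mulfK.
exists (fun y => if y == z then l else (f y - f z) / (y - z)).
  rewrite -[X in _ --> X](_ : (if z == z then l else (f z - f z) / (z - z)) = l); last by rewrite eqxx.
  apply/continuous_withinNshiftx; rewrite eqxx /=.
  apply: cvg_trans H; apply: near_eq_cvg.
  near=> i; rewrite /= ifN; first by rewrite addrK mulrC /= [_%:A]mulr1.
  rewrite -subr_eq0 addrK; near: i; exact: nbhs_dnbhs_neq.
split; first by rewrite eqxx.
near=> y; case: eqP => [->|/eqP]; first by rewrite !subrr mulr0.
by rewrite -subr_eq0 => /divfK->.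
Unshelve. all: by end_near. Qed.

Lemma cder_derivable (f : C -> C) z l : cder f z l -> derivable f z 1 /\ derive1 f z = l.
Proof.
move=> /hasder_limit H; split; first by apply/cvg_ex; exists l.
rewrite derive1E; apply: cvg_lim; [exact: norm_hausdorff|exact H].
Qed.

Lemma derivable_cder (f : C -> C) z : derivable f z 1 -> cder f z (derive1 f z).
Proof.
move=> /cvg_ex[l H]; have d : cder f z l by apply/hasder_limit.
by have [_ ->] := cder_derivable d.
Qed.

Lemma is_derive_near (f : R -> R) (s l : R) :
  is_derive s (1 : R) f l <-> (exists2 phi : R -> R, phi @ s --> l &
    phi s = l /\ \forall y \near s, f y - f s = phi y * (y - s)).
Proof.
split=> [H|/hasder_limit H].
  apply/hasder_limit; case: H => H <-; exact: H.
have d : derivable f s 1 by apply/cvg_ex; exists l.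
by apply: DeriveDef => //; apply: cvg_lim.
Qed.

Lemma rderP (c : R -> C) (s : R) l : rder c s l <->
  is_derive s (1 : R) (fun t => Re (c t)) (Re l) /\ is_derive s (1 : R) (fun t => Im (c t)) (Im l).
Proof.
split=> [[phi cp [pl dp]]|[/is_derive_near[p cp [pl dp]] /is_derive_near[q cq [ql dq]]]].
  split; apply/is_derive_near.
    exists (fun t => Re (phi t)); first exact: at_Re.
    split; first by rewrite pl.
    near=> y; have -> : Re (c y) - Re (c s) = Re (c y - c s) by rewrite !ReImE.
    have -> : c y - c s = phi y * (rc y - rc s) by near: y.
    rewrite !ReImE ?subr0 /=; ring.
  exists (fun t => Im (phi t)); first exact: at_Im.
  split; first by rewrite pl.
  near=> y; have -> : Im (c y) - Im (c s) = Im (c y - c s) by rewrite !ReImE.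
  have -> : c y - c s = phi y * (rc y - rc s) by near: y.
    rewrite !ReImE ?subr0 /=; ring.
exists (fun t => Complex (p t) (q t)); first exact: at_ReIm.
split; first by apply: complex_ext; rewrite /= ?pl ?ql.
near=> y; apply: complex_ext; rewrite !ReImE /=.
  have -> : Re (c y) - Re (c s) = p y * (y - s) by near: y.
  ring.
have -> : Im (c y) - Im (c s) = q y * (y - s) by near: y.
ring.
Unshelve. all: by end_near. Qed.

Lemma rder_rc (f : R -> R) (s l : R) : is_derive s (1 : R) f l -> rder (fun t => rc (f t)) s (rc l).
Proof. by move=> H; apply/rderP; split => //=; exact: is_derive_cst. Qed.

Lemma real_mvt (f df : R -> R) (a b : R) : a <= b ->
  (forall x : R, a <= x <= b -> is_derive x (1 : R) f (df x)) ->
  exists2 c, a <= c <= b & f b - f a = df c * (b - a).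
Proof.
rewrite le_eqVlt => /predU1P[->|ab] H.
  by exists b; rewrite ?lexx // !subrr mulr0.
have [||c] := @MVT R f df a b ab.
- by move=> x; rewrite in_itv /= => /andP[? ?]; apply: H; rewrite !ltW.
- apply: derivable_within_continuous => x; rewrite in_itv /= => h.
  by have [] := H x h.
by rewrite in_itv /= => /andP[? ?] ?; exists c => //; rewrite !ltW.
Qed.

(** Projecting H on the direction of D = H b - H a reduces to the real mean
    value theorem without losing a constant. *)
Lemma mvt_bound (H h : R -> C) (a b M : R) : a <= b ->
  (forall x, a <= x <= b -> rder H x (h x) /\ cmod (h x) <= M) ->
  cmod (H b - H a) <= M * (b - a).
Proof.
move=> ab dH; set D := H b - H a.
pose f x := Re (cconj D * H x).
have [|c cab] := @real_mvt f (fun x => Re (cconj D * h x)) a b ab.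
  move=> x /dH[dx _].
  have /rderP[] : rder (fun x => cconj D * H x) x (cconj D * h x) => //.
  apply: der_eq; first exact: (rderM (der_cst _ _ _) dx).
  by rewrite mul0r add0r.
have -> : f b - f a = cmod D ^+ 2.
  by rewrite /f -ReN -ReD -mulrN -mulrDr -/D mulrC mul_conj.
move=> E; have [->|D0] := eqVneq D 0.
  rewrite cmod0 mulr_ge0 ?subr_ge0 //.
  exact: le_trans (cmod_ge0 _) (dH c cab).2.
have D0' : 0 < cmod D by rewrite cmod_gt0.
rewrite -(ler_pM2l D0') -expr2 E mulrA ler_wpM2r ?subr_ge0 //.
apply: le_trans (le_trans (ler_norm _) (Re_cmod _)) _.
rewrite cmodM cmod_conj; have [_ ?] := dH c cab; apply: ler_wpM2l; [exact: cmod_ge0|by []].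
Qed.

Lemma rder0_cst (H : R -> C) (a b : R) :
  (forall x, a <= x <= b -> rder H x 0) -> a <= b -> H b = H a.
Proof.
move=> d ab; apply/eqP; rewrite -subr_eq0 -cmod_eq0 eq_le cmod_ge0 andbT.
rewrite -(mul0r (b - a)); apply: (mvt_bound (h := fun=> 0)) => // x /d; by rewrite cmod0.
Qed.

End Derivatives.

(** * Integrals depending on a complex parameter *)
Section Integrals.
Variable R : realType.
Local Notation C := (Cplx R).
Local Notation Re := (@complex.Re R).
Local Notation Im := (@complex.Im R).
Local Notation rc := (@rc R).
Local Notation ic := (@ic R).
Local Notation mu := (@lebesgue_measure R).
Implicit Types (T M e d : R) (z : C).

Lemma real_der0_cst (f : R -> R) (a b : R) : a <= b ->
  (forall x : R, a <= x <= b -> is_derive x (1 : R) f 0) -> f b = f a.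
Proof.
move=> ab d; have [c _] := real_mvt ab d.
by rewrite mul0r => /eqP; rewrite subr_eq0 => /eqP.
Qed.

Lemma antiderivative_right (h : R -> R) (a : R) : continuous h ->
  exists F : R -> R, forall x, a < x -> is_derive x (1 : R) F (h x).
Proof.
move=> ch; exists (fun x => \int[mu]_(t in [set` `[a, x]]) (h t))%R => x ax.
have [||d1 d2] := @continuous_FTC1_closed R h a x (x + 1) _ _ ax (ch x).
- by rewrite ltrDl.
- apply: continuous_compact_integrable; first exact: segment_compact.
  exact: continuous_subspaceT.
apply: DeriveDef; [exact d1|rewrite -derive1E; exact d2].
Qed.

(** The primitives on ]-n, +oo[ that vanish at 0 differ by a function with zero
    derivative, hence agree where they are both defined: at x it suffices to
    use any n > |x|. *)
Lemma antiderivative_exists (h : R -> R) : continuous h ->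
  exists H : R -> R, forall x : R, is_derive x (1 : R) H (h x).
Proof.
move=> ch.
have /choice[F dF] := fun n : nat => antiderivative_right (- n%:R) ch.
pose N (x : R) := Num.bound `|x|.
have NP x : `|x| < (N x)%:R by rewrite archi_boundP.
exists (fun x => F (N x) x - F (N x) 0) => x.
have cst (n m : nat) (y : R) : `|y| < n%:R -> `|y| < m%:R ->
    F n y - F n 0 = F m y - F m 0.
  move=> yn ym.
  have n0 : (0 : R) < n%:R := le_lt_trans (normr_ge0 _) yn.
  have m0 : (0 : R) < m%:R := le_lt_trans (normr_ge0 _) ym.
  have D (z : R) : - n%:R < z -> - m%:R < z -> is_derive z (1 : R) (fun v => F n v - F m v) 0.
    move=> h1 h2; rewrite -(subrr (h z)).
    by apply: is_deriveB; apply: dF.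
  move: yn ym; rewrite !ltr_norml => /andP[y1 y2] /andP[y3 y4].
  have E : F n y - F m y = F n 0 - F m 0.
    have [y0|/ltW y0] := leP 0 y.
      apply: (@real_der0_cst (fun v => F n v - F m v)) => // v /andP[v1 v2].
      by apply: D; lra.
    apply/esym.
    apply: (@real_der0_cst (fun v => F n v - F m v)) => // v /andP[v1 v2].
    by apply: D; lra.
  apply/eqP; rewrite -subr_eq0; apply/eqP.
  have -> : F n y - F n 0 - (F m y - F m 0) = (F n y - F m y) - (F n 0 - F m 0) by ring.
  by rewrite E subrr.
have xN := NP x; set m := N x in xN *.
have /is_derive_near[p cp [pl dp]] : is_derive x (1 : R) (F m) (h x).
  by apply: dF; move: xN; rewrite ltr_norml => /andP[].
apply/is_derive_near; exists p => //; split=> //.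
have nx : \forall y \near x, `|y| < m%:R.
  apply/nbhs_real; exists (m%:R - `|x|); first by rewrite subr_gt0.
  move=> y yx; have := ler_normB (y - x) (- x).
  by rewrite opprK subrK normrN; lra.
near=> y.
have E1 : F m y - F m x = p y * (y - x) by near: y.
have ym : `|y| < m%:R by near: y.
rewrite -E1 (cst (N y) m y) //; ring.
Unshelve. all: by end_near. Qed.

Lemma rder_antiderivative (h : R -> C) : continuous h ->
  exists H : R -> C, forall s, rder H s (h s).
Proof.
move=> ch.
have [p dp] : exists p : R -> R, forall x : R, is_derive x (1 : R) p (Re (h x)).
  by apply: antiderivative_exists => x; exact: (at_Re (ch x)).
have [q dq] : exists p : R -> R, forall x : R, is_derive x (1 : R) p (Im (h x)).
  by apply: antiderivative_exists => x; exact: (at_Im (ch x)).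
by exists (fun s => Complex (p s) (q s)) => s; apply/rderP; split; [exact: dp|exact: dq].
Qed.

Definition cprim (h : R -> C) : R -> C := xget (fun=> 0) [set H | forall s, rder H s (h s)].

Lemma cprimP (h : R -> C) : continuous h -> forall s, rder (cprim h) s (h s).
Proof.
move=> /rder_antiderivative[H dH]; rewrite /cprim; case: xgetP => [F _ //|].
by move=> /(_ H).
Qed.

(** The integral of h over [0, T] as the increment of a primitive: linearity,
    bounds and evaluation all reduce to facts about derivatives. *)
Definition cint (h : R -> C) (T : R) : C := cprim h T - cprim h 0.

Lemma cint_prim (h H : R -> C) T : 0 <= T -> continuous h ->
  (forall s, 0 <= s <= T -> rder H s (h s)) -> cint h T = H T - H 0.
Proof.
move=> T0 ch dH; rewrite /cint.
have E : cprim h T - H T = cprim h 0 - H 0.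
  apply: (@rder0_cst _ (fun s => cprim h s - H s)) => // s hs.
  by rewrite -(subrr (h s)); apply: derB; [exact: cprimP|exact: dH].
rewrite -[cprim h T](subrK (H T)) E; ring.
Qed.

Lemma cint_ext (h k : R -> C) T : h =1 k -> cint h T = cint k T.
Proof. by move=> /funext->. Qed.

Lemma cintB_bound (h k : R -> C) T M : 0 <= T -> continuous h -> continuous k ->
  (forall s, 0 <= s <= T -> cmod (h s - k s) <= M) ->
  cmod (cint h T - cint k T) <= M * T.
Proof.
move=> T0 ch ck hM; rewrite -[in leRHS](subr0 T).
have -> : cint h T - cint k T = (cprim h T - cprim k T) - (cprim h 0 - cprim k 0).
  by rewrite /cint; ring.
apply: (@mvt_bound _ (fun s => cprim h s - cprim k s) (fun s => h s - k s)) => // s hs.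
by split; [apply: derB; exact: cprimP|exact: hM].
Qed.

Lemma cintZ (h : R -> C) (k : C) T : 0 <= T -> continuous h ->
  cint (fun s => k * h s) T = k * cint h T.
Proof.
move=> T0 ch.
have ckh : continuous (fun s => k * h s) by move=> s; exact (atM (at_cst k) (ch s)).
have -> := cint_prim T0 ckh (H := fun s => k * cprim h s).
  by rewrite /cint mulrBr.
move=> s _; apply: der_eq; first exact: (rderM (der_cst _ _ _) (cprimP ch s)).
by rewrite mul0r add0r.
Qed.

Lemma cintD (h k : R -> C) T : 0 <= T -> continuous h -> continuous k ->
  cint (fun s => h s + k s) T = cint h T + cint k T.
Proof.
move=> T0 ch ck.
have chk : continuous (fun s => h s + k s) by move=> s; exact (atD (ch s) (ck s)).
have -> := cint_prim T0 chk (H := fun s => cprim h s + cprim k s).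
  by rewrite /cint; ring.
by move=> s _; apply: derD; exact: cprimP.
Qed.

Lemma cint_cst (k : C) T : 0 <= T -> cint (fun=> k) T = rc T * k.
Proof.
move=> T0.
have ck : continuous (fun _ : R => k) by move=> s; exact (at_cst k).
have -> := cint_prim T0 ck (H := fun s => 0 + rc s * k).
  by rewrite !rc0; ring.
by move=> s _; exact: rder_line.
Qed.

(** If no d worked, failures s_n with d = 1 / (n + 1) would cluster at a point
    near which some d does work. *)
Lemma segment_uniform (P : R -> R -> Prop) T :
  (forall s d d', P s d -> 0 < d' <= d -> P s d') ->
  (forall s, 0 <= s <= T -> exists2 d, 0 < d & \forall s' \near s, P s' d) ->
  exists2 d, 0 < d & forall s, 0 <= s <= T -> P s d.
Proof.
move=> mono loc; apply: contrapT => H.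
have /choice[u uP] : forall n : nat, exists s, 0 <= s <= T /\ ~ P s (n.+1%:R)^-1.
  move=> n; apply: contrapT => H1; apply: H; exists n.+1%:R^-1 => // s hs.
  by apply: contrapT => H2; apply: H1; exists s.
have [|s] := @cluster_seq _ _ u (@segment_compact _ 0 T).
  by move=> n /=; rewrite in_itv /=; exact: (uP n).1.
rewrite /= in_itv /= => /loc[d d0 Hd] cl.
have [n nN] := cl _ Hd (Num.bound d^-1).
move=> Pud; apply: (uP n).2; apply: mono Pud _.
rewrite invr_gt0 ltr0n /= -[leRHS]invrK lef_pV2 ?posrE ?invr_gt0 ?ltr0n //.
apply: ltW; apply: lt_le_trans (archi_boundP _) _; first by rewrite invr_ge0 ltW.
by rewrite ler_nat (leq_trans nN).
Qed.

Lemma uniform_cvg (k : C -> R -> C) z0 T :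
  (forall s, 0 <= s <= T -> (fun p : C * R => k p.1 p.2) @ (z0, s) --> k z0 s) ->
  forall e, 0 < e -> exists2 d, 0 < d & forall s, 0 <= s <= T ->
    forall z, cmod (z - z0) < d -> cmod (k z s - k z0 s) < e.
Proof.
move=> ck e e0.
apply: (@segment_uniform (fun s d => forall z, cmod (z - z0) < d -> cmod (k z s - k z0 s) < e)).
  by move=> s d d' H /andP[_ dd'] z /lt_le_trans-/(_ _ dd'); exact: H.
move=> s /ck/cvg_cmod/(_ (e / 2)); rewrite divr_gt0 // => /(_ isT).
move=> [[A B] /= [/nbhs_cmod[d d0 dA] nB] AB]; exists d => //.
near=> s'; have Bs' : B s' by near: s'.
move=> z zd.
have h1 : cmod (k z s' - k z0 s) < e / 2 by apply: (AB (z, s')); split => //=; exact: dA.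
have h2 : cmod (k z0 s' - k z0 s) < e / 2.
  by apply: (AB (z0, s')); split => //=; apply: dA; rewrite subrr cmod0.
rewrite [ltRHS]splitr; apply: le_lt_trans (cmod_triangle (k z0 s) _ _) _.
by rewrite ltrD // cmodC.
Unshelve. all: by end_near. Qed.

Lemma cint_param_cvg (k : C -> R -> C) z0 T : 0 <= T ->
  (\forall z \near z0, continuous (k z)) ->
  (forall s, 0 <= s <= T -> (fun p : C * R => k p.1 p.2) @ (z0, s) --> k z0 s) ->
  (fun z => cint (k z) T) @ z0 --> cint (k z0) T.
Proof.
move=> T0 ck /uniform_cvg uk; apply/cvg_cmod => e e0.
have e1 : 0 < e / (T + 1) by rewrite divr_gt0 // ltr_wpDl.
have [d d0 Hd] := uk _ e1.
have ck0 := nbhs_singleton ck.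
near=> z; apply: (@le_lt_trans _ _ (e / (T + 1) * T)).
  apply: (cintB_bound T0) => [||s hs]; [by near: z|exact ck0|].
  apply/ltW/Hd => //; near: z; exact: near_cmod.
rewrite -mulrA gtr_pMr // [X in X < _]mulrC ltr_pdivrMr ?mul1r ?ltrDl //.
by rewrite ltr_wpDl.
Unshelve. all: by end_near. Qed.

(** This is mvt_bound for F z - l z along the segment from z0 to z. *)
Lemma segment_bound (F f : C -> C) z0 z (l : C) M :
  (forall t : R, 0 <= t <= 1 -> cder F (z0 + rc t * (z - z0)) (f (z0 + rc t * (z - z0))) /\
     cmod (f (z0 + rc t * (z - z0)) - l) <= M) ->
  cmod (F z - F z0 - l * (z - z0)) <= M * cmod (z - z0).
Proof.
move=> H; pose G (t : R) := F (z0 + rc t * (z - z0)) - l * (z0 + rc t * (z - z0)).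
have -> : F z - F z0 - l * (z - z0) = G 1 - G 0.
  by rewrite /G rc1 rc0 mul1r mul0r addr0 subrKC; ring.
rewrite -[leRHS]mulr1 -[X in _ * X](subr0 1).
apply: (@mvt_bound _ G (fun t => (f (z0 + rc t * (z - z0)) - l) * (z - z0))) => // t /H[dF b].
split; last by rewrite cmodM ler_wpM2r // cmod_ge0.
rewrite mulrBl; apply: derB.
  exact: (rder_comp dF (rder_line _ _ _)).
apply: der_eq; first exact: (rderM (der_cst _ _ _) (rder_line _ _ _)).
by rewrite mul0r add0r.
Qed.

(** Differentiation under the integral sign: by segment_bound the difference
    quotients of k ^~ s converge to k1 z0 s uniformly in s. *)
Lemma cint_param_der (k k1 : C -> R -> C) z0 T : 0 <= T ->
  (\forall z \near z0, continuous (k z)) -> continuous (k1 z0) ->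
  (\forall z \near z0, forall s, 0 <= s <= T -> cder (k ^~ s) z (k1 z s)) ->
  (forall s, 0 <= s <= T -> (fun p : C * R => k1 p.1 p.2) @ (z0, s) --> k1 z0 s) ->
  cder (fun z => cint (k z) T) z0 (cint (k1 z0) T).
Proof.
move=> T0 ck ck1 dk /uniform_cvg uk1.
have ck0 := nbhs_singleton ck.
pose Q z := (cint (k z) T - cint (k z0) T) / (z - z0).
pose phi z := if z == z0 then cint (k1 z0) T else Q z.
exists phi; last first.
  split; first by rewrite /phi eqxx.
  near=> z; rewrite /phi /Q; case: eqP => [->|/eqP]; first by rewrite !subrr mulr0.
  by rewrite -subr_eq0 => /divfK->.
apply/cvg_cmod => e e0.
have e1 : 0 < e / (T + 1) by rewrite divr_gt0 // ltr_wpDl.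
have [d d0 Hd] := uk1 _ e1.
have /nbhs_cmod[r r0 Hr] := dk.
near=> z; rewrite /phi; case: eqP => [_|/eqP zz0]; first by rewrite subrr cmod0.
rewrite -subr_eq0 in zz0; have zz1 : 0 < cmod (z - z0) by rewrite cmod_gt0.
have ckz : continuous (k z) by near: z.
rewrite -(ltr_pM2r zz1) -cmodM mulrBl /Q divfK //.
have -> : cint (k1 z0) T * (z - z0) = cint (fun s => (z - z0) * k1 z0 s) T.
  by rewrite (cintZ _ T0 ck1) mulrC.
have -> : cint (k z) T - cint (k z0) T = cint (fun s => k z s + (-1) * k z0 s) T.
  have ck0' : continuous (fun s => (-1) * k z0 s).
    by move=> s; exact (atM (at_cst _) (ck0 s)).
  by rewrite (cintD T0 ckz ck0') (cintZ _ T0 ck0) mulN1r.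
apply: (@le_lt_trans _ _ (e / (T + 1) * cmod (z - z0) * T)).
  apply: (cintB_bound T0).
  - by move=> s; exact (atD (ckz s) (atM (at_cst _) (ck0 s))).
  - by move=> s; exact (atM (at_cst _) (ck1 s)).
  move=> s hs; rewrite mulN1r [X in _ - X]mulrC.
  apply: (@segment_bound (k ^~ s) (k1 ^~ s)) => t /andP[t0 t1].
  have tz : cmod (z0 + rc t * (z - z0) - z0) <= cmod (z - z0).
    by rewrite addrC addKr cmodM cmod_rc ger0_norm // ler_piMl // cmod_ge0.
  split.
    apply: Hr => //; apply: le_lt_trans tz _; near: z; exact: near_cmod.
  apply/ltW/Hd => //; apply: le_lt_trans tz _; near: z; exact: near_cmod.
rewrite mulrAC ltr_pM2r // -mulrA gtr_pMr // [X in X < _]mulrC ltr_pdivrMr ?mul1r ?ltrDl //.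
by rewrite ltr_wpDl.
Unshelve. all: by end_near. Qed.

Lemma Rintegral_prim (h H : R -> R) : continuous h ->
  (forall x : R, is_derive x (1 : R) H (h x)) ->
  (\int[mu]_(s in `[0%R, 1%R]) h s)%R = H 1 - H 0.
Proof.
move=> ch dH; rewrite /Rintegral (@continuous_FTC2 R h H 0 1) //.
- exact: continuous_subspaceT.
- have cH (x : R) : H @ x --> H x.
    by apply: differentiable_continuous; apply/derivable1_diffP; have [] := dH x.
  split.
  + by move=> x _; have [] := dH x.
  + by apply: cvg_at_right_filter; exact: cH.
  + by apply: cvg_at_left_filter; exact: cH.
- by move=> x _; rewrite derive1E; have [] := dH x.
Qed.

End Integrals.

(** * The complex exponential *)
Section Exponential.
Variable R : realType.
Local Notation C := (Cplx R).
Local Notation Re := (@complex.Re R).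
Local Notation Im := (@complex.Im R).
Local Notation rc := (@rc R).
Local Notation ic := (@ic R).

Definition cexp (z : C) : C := Complex (expR (Re z) * cos (Im z)) (expR (Re z) * sin (Im z)).

Lemma Re_cexp z : Re (cexp z) = expR (Re z) * cos (Im z). Proof. by []. Qed.
Lemma Im_cexp z : Im (cexp z) = expR (Re z) * sin (Im z). Proof. by []. Qed.

Lemma cexpD (z u : C) : cexp (z + u) = cexp z * cexp u.
Proof.
apply: complex_ext; rewrite !(ReImE, Re_cexp, Im_cexp) expRD ?cosD ?sinD; ring.
Qed.

Lemma cexp0 : cexp 0 = 1.
Proof. by apply: complex_ext; rewrite /= expR0 ?cos0 ?sin0 ?mulr1 ?mulr0. Qed.

Lemma cmod_cexp (z : C) : cmod (cexp z) = expR (Re z).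
Proof.
rewrite cmodE /= !exprMn -mulrDr cos2Dsin2 mulr1 sqrtr_sqr.
by rewrite ger0_norm // expR_ge0.
Qed.

Lemma cexp_neq0 (z : C) : cexp z != 0.
Proof. by rewrite -cmod_gt0 cmod_cexp expR_gt0. Qed.

Lemma cexpN (z : C) : cexp (- z) = (cexp z)^-1.
Proof.
by apply: (mulfI (cexp_neq0 z)); rewrite -cexpD subrr cexp0 divff // cexp_neq0.
Qed.

Lemma cexp_rc (x : R) : cexp (rc x) = rc (expR x).
Proof. by apply: complex_ext; rewrite /= ?cos0 ?sin0 ?mulr1 ?mulr0. Qed.

Lemma cexp_2pi (z : C) : cexp (z + ic * rc (pi *+ 2)) = cexp z.
Proof.
have e1 : Re (z + ic * rc (pi *+ 2)) = Re z by rewrite !ReImE; ring.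
have e2 : Im (z + ic * rc (pi *+ 2)) = Im z + pi *+ 2 by rewrite !ReImE; ring.
by apply: complex_ext; rewrite !(Re_cexp, Im_cexp) e1 e2 ?cosD2pi ?sinD2pi.
Qed.

(** e^z - 1 - z = A z Re z + B z Im z with A and B tending to 0 at 0: this only
    uses the real derivatives of exp, cos and sin at 0. *)
Lemma cder_cexp0 : cder cexp 0 1.
Proof.
have /is_derive1_caratheodory[p [dp cp p0]] : is_derive (0 : R) (1 : R) (@expR R) 1.
  by rewrite -{2}(@expR0 R); exact: is_derive_expR.
have /is_derive1_caratheodory[q [dq cq q0]] : is_derive (0 : R) (1 : R) (@cos R) 0.
  by rewrite -{2}(oppr0) -{2}(@sin0 R); exact: is_derive_cos.
have /is_derive1_caratheodory[r [dr cr r0]] : is_derive (0 : R) (1 : R) (@sin R) 1.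
  by rewrite -{2}(@cos0 R); exact: is_derive_sin.
pose u (z : C) : C := Complex (cos (Im z)) (sin (Im z)).
pose A z := rc (p (Re z)) * u z - 1.
pose B z := rc (q (Im z)) + ic * rc (r (Im z)) - ic.
have E (z : C) : cexp z - 1 - z = A z * rc (Re z) + B z * rc (Im z).
  have h1 := dp (Re z); have h2 := dq (Im z); have h3 := dr (Im z).
  rewrite !subr0 expR0 in h1; rewrite !subr0 cos0 in h2; rewrite !subr0 sin0 subr0 in h3.
  have Re1 : Re (1 : C) = 1 by [].
  have Im1 : Im (1 : C) = 0 by [].
  have Reu : Re (u z) = cos (Im z) by [].
  have Imu : Im (u z) = sin (Im z) by [].
  apply: complex_ext; rewrite /A /B !(ReImE, Re_cexp, Im_cexp, Reu, Imu, Re1, Im1).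
    have -> : expR (Re z) = p (Re z) * Re z + 1 by lra.
    rewrite h3; have -> : cos (Im z) = q (Im z) * Im z + 1 by lra.
    ring.
  have -> : expR (Re z) = p (Re z) * Re z + 1 by lra.
  rewrite h3; ring.
have cid : (fun z : C => z) @ (0 : C) --> (0 : C) by exact: cvg_id.
have cRe : (fun z : C => Re z) @ (0 : C) --> (0 : R) by exact (at_Re cid).
have cIm : (fun z : C => Im z) @ (0 : C) --> (0 : R) by exact (at_Im cid).
have cu : u @ (0 : C) --> (1 : C).
  apply: at_ReIm => /=.
    by rewrite -(@cos0 R); exact: (cvg_comp _ _ cIm (@continuous_cos R 0)).
  by rewrite -(@sin0 R); exact: (cvg_comp _ _ cIm (@continuous_sin R 0)).
have cp' : p @ (0 : R) --> (1 : R) by rewrite -p0; exact cp.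
have cq' : q @ (0 : R) --> (0 : R) by rewrite -[X in _ --> X]q0; exact cq.
have cr' : r @ (0 : R) --> (1 : R) by rewrite -r0; exact cr.
have cpR : (fun z : C => rc (p (Re z))) @ (0 : C) --> (1 : C).
  exact (at_rc (cvg_comp _ _ cRe cp')).
have cqR : (fun z : C => rc (q (Im z))) @ (0 : C) --> (0 : C).
  exact (at_rc (cvg_comp _ _ cIm cq')).
have crR : (fun z : C => rc (r (Im z))) @ (0 : C) --> (1 : C).
  exact (at_rc (cvg_comp _ _ cIm cr')).
have cA : A @ (0 : C) --> (0 : C).
  have := atB (atM cpR cu) (@at_cst R C 0 1); rewrite mulr1 subrr => H; exact H.
have cB : B @ (0 : C) --> (0 : C).
  have := atB (atD cqR (atM (@at_cst R C 0 ic) crR)) (@at_cst R C 0 ic).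
  rewrite mulr1 add0r subrr => H; exact H.
exists (fun z => if z == 0 then 1 else (cexp z - 1) / z); last first.
  split; first by rewrite eqxx.
  near=> z; rewrite cexp0 subr0; case: eqP => [->|/eqP z0].
    by rewrite cexp0 subrr mulr0.
  by rewrite divfK.
apply/cvg_cmod => e e0.
have e2 : 0 < e / 2 by rewrite divr_gt0.
have /cvg_cmod/(_ _ e2) nA := cA.
have /cvg_cmod/(_ _ e2) nB := cB.
near=> z; case: eqP => [_|/eqP z0]; first by rewrite subrr cmod0.
have z1 : 0 < cmod z by rewrite cmod_gt0.
rewrite -(ltr_pM2r z1) -cmodM mulrBl divfK // mul1r E.
have Az : cmod (A z) < e / 2 by rewrite -(subr0 (A z)); near: z.
have Bz : cmod (B z) < e / 2 by rewrite -(subr0 (B z)); near: z.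
apply: le_lt_trans (cmodD _ _) _; rewrite !cmodM !cmod_rc.
apply: (@le_lt_trans _ _ (cmod (A z) * cmod z + cmod (B z) * cmod z)).
  by rewrite lerD // ler_wpM2l ?cmod_ge0 ?Re_cmod ?Im_cmod.
by rewrite -mulrDl ltr_pM2r // [ltRHS]splitr ltrD.
Unshelve. all: by end_near. Qed.

Lemma cder_cexp (z : C) : cder cexp z (cexp z).
Proof.
have d1 : cder (fun u => u - z) z 1.
  by have := derB (cder_id z) (der_cst id z z); rewrite subr0.
have d2 : cder cexp (z - z) 1 by rewrite subrr; exact: cder_cexp0.
have d3 := cder_comp (f := fun u => u - z) d2 d1.
have d4 := cderM (der_cst id (cexp z) z) d3.
rewrite mul0r add0r !mulr1 in d4.
by apply: der_ext d4 => u; rewrite -cexpD addrC subrK.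
Qed.

Lemma cexp_continuous : continuous cexp.
Proof. by move=> z; exact (cder_cvg (cder_cexp z)). Qed.

Lemma rder_cexp_line (z u : C) (s : R) :
  rder (fun s => cexp (z + rc s * u)) s (cexp (z + rc s * u) * u).
Proof. exact: (rder_comp (cder_cexp _) (rder_line _ _ _)). Qed.

Definition cis (s : R) : C := cexp (ic * rc s).

Lemma cmod_cis s : cmod (cis s) = 1.
Proof. by rewrite cmod_cexp !ReImE mul0r mulr0 subr0 expR0. Qed.

Lemma rder_cis s : rder cis s (ic * cis s).
Proof.
have := rder_cexp_line 0 ic s; rewrite add0r [X in rder _ _ X]mulrC [rc s * ic]mulrC.
by apply: der_ext => y; rewrite add0r mulrC.
Qed.

Lemma cis_continuous : continuous cis.
Proof. by move=> s; exact (rder_cvg (rder_cis s)). Qed.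

Lemma cis_2pi : cis (pi *+ 2) = cis 0.
Proof. by rewrite /cis -[ic * rc (pi *+ 2)]add0r cexp_2pi rc0 mulr0. Qed.

Lemma cis_neq0 s : cis s != 0. Proof. exact: cexp_neq0. Qed.

End Exponential.

(** * Goursat's theorem on rectangles *)
Section Goursat.
Variable R : realType.
Implicit Types X Y W H x y e : R.
Local Notation C := (Cplx R).
Local Notation Re := (@complex.Re R).
Local Notation Im := (@complex.Im R).
Local Notation rc := (@rc R).
Local Notation ic := (@ic R).

Lemma nested_point (x w : nat -> R) : (forall n, x n <= x n.+1) ->
  (forall n, x n.+1 + w n.+1 <= x n + w n) -> (forall n, 0 <= w n) ->
  exists p, forall n, x n <= p <= x n + w n.
Proof.
move=> xi wi w0.
have mx n m : (n <= m)%N -> x n <= x m.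
  elim: m => [|m IH]; first by rewrite leqn0 => /eqP->.
  rewrite leq_eqVlt => /predU1P[-> //|]; rewrite ltnS => /IH h; exact: le_trans h (xi m).
have mw n m : (n <= m)%N -> x m + w m <= x n + w n.
  elim: m => [|m IH]; first by rewrite leqn0 => /eqP->.
  rewrite leq_eqVlt => /predU1P[-> //|]; rewrite ltnS => /IH h; exact: le_trans (wi m) h.
have ub n m : x m <= x n + w n.
  have [nm|/ltnW mn] := leqP n m.
    by apply: le_trans (mw _ _ nm); rewrite lerDl.
  by apply: le_trans (mx _ _ mn) _; rewrite lerDl.
have hs : has_sup (range x).
  by split; [exists (x 0), 0|exists (x 0 + w 0) => _ [m _ <-]].
exists (sup (range x)) => n; apply/andP; split.
  by apply: sup_upper_bound => //; exists n.
by apply: ge_sup; [exists (x 0), 0|move=> _ [m _ <-]].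
Qed.

(** A property of rectangles [x, x + w] x [y, y + h] that passes from the four
    quarters to the whole, and holds for the small rectangles around each point,
    holds: otherwise it would fail on nested rectangles shrinking to a point. *)
Lemma quadrisection (P : R -> R -> R -> R -> Prop) X Y W H : 0 <= W -> 0 <= H ->
  (forall x y w h, P x y (w / 2) (h / 2) -> P (x + w / 2) y (w / 2) (h / 2) ->
     P x (y + h / 2) (w / 2) (h / 2) -> P (x + w / 2) (y + h / 2) (w / 2) (h / 2) -> P x y w h) ->
  (forall px py, X <= px <= X + W -> Y <= py <= Y + H -> exists2 d, 0 < d &
     forall x y w h, X <= x -> x + w <= X + W -> Y <= y -> y + h <= Y + H ->
       x <= px <= x + w -> y <= py <= y + h -> w + h < d -> P x y w h) ->
  P X Y W H.
Proof.
move=> W0 H0 quad loc; apply: contrapT => nP.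
pose wn n := W / 2 ^+ n; pose hn n := H / 2 ^+ n.
have wS n : wn n.+1 = wn n / 2 by rewrite /wn exprS invfM; ring.
have hS n : hn n.+1 = hn n / 2 by rewrite /hn exprS invfM; ring.
have step (n : nat) (q : R * R) : exists q' : R * R,
    ~ P q.1 q.2 (wn n) (hn n) -> ~ P q'.1 q'.2 (wn n.+1) (hn n.+1) /\
    ((q'.1 = q.1 \/ q'.1 = q.1 + wn n.+1) /\ (q'.2 = q.2 \/ q'.2 = q.2 + hn n.+1)).
  rewrite wS hS; set w := wn n; set h := hn n; case: q => x y /=.
  have [h1|h1] := pselect (P x y w h); first by exists (x, y).
  have [p1|p1] := pselect (P x y (w / 2) (h / 2)); last by exists (x, y) => _ /=; tauto.
  have [p2|p2] := pselect (P (x + w / 2) y (w / 2) (h / 2)); last by exists (x + w / 2, y) => _ /=; tauto.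
  have [p3|p3] := pselect (P x (y + h / 2) (w / 2) (h / 2)); last by exists (x, y + h / 2) => _ /=; tauto.
  have [p4|p4] := pselect (P (x + w / 2) (y + h / 2) (w / 2) (h / 2)).
    by case: h1; exact: quad.
  by exists (x + w / 2, y + h / 2) => _ /=; tauto.
have /choice[nxt nxtP] : forall nq : nat * (R * R), exists q', ~ P nq.2.1 nq.2.2 (wn nq.1) (hn nq.1) ->
    ~ P q'.1 q'.2 (wn nq.1.+1) (hn nq.1.+1) /\
    ((q'.1 = nq.2.1 \/ q'.1 = nq.2.1 + wn nq.1.+1) /\ (q'.2 = nq.2.2 \/ q'.2 = nq.2.2 + hn nq.1.+1)).
  by case=> n q; exact: step.
pose s := fix s n := if n is m.+1 then nxt (m, s m) else (X, Y).
have nPs n : ~ P (s n).1 (s n).2 (wn n) (hn n).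
  elim: n => [|n IH]; first by rewrite /= /wn /hn !expr0 !divr1.
  by have [] := nxtP (n, s n) IH.
have sS n := (nxtP (n, s n) (nPs n)).2.
have wn0 n : 0 <= wn n by rewrite divr_ge0 // exprn_ge0.
have hn0 n : 0 <= hn n by rewrite divr_ge0 // exprn_ge0.
have x1 n : (s n).1 <= (s n.+1).1.
  by have /= := sS n; case=> -[-> _ //|-> _]; rewrite lerDl.
have x2 n : (s n.+1).1 + wn n.+1 <= (s n).1 + wn n.
  have := wn0 n; have := wS n; have /= := sS n; case=> -[-> _ //|-> _]; lra.
have y1 n : (s n).2 <= (s n.+1).2.
  by have /= := sS n; case=> _ -[-> //|->]; rewrite lerDl.
have y2 n : (s n.+1).2 + hn n.+1 <= (s n).2 + hn n.
  have := hn0 n; have := hS n; have /= := sS n; case=> _ -[-> //|->]; lra.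
have [px pxP] := nested_point x1 x2 wn0.
have [py pyP] := nested_point y1 y2 hn0.
have w00 : wn 0 = W by rewrite /wn expr0 divr1.
have h00 : hn 0 = H by rewrite /hn expr0 divr1.
have [||d d0 loc0] := loc px py.
- by have := pxP 0%N; rewrite w00.
- by have := pyP 0%N; rewrite h00.
have mono n : [/\ X <= (s n).1, (s n).1 + wn n <= X + W, Y <= (s n).2 & (s n).2 + hn n <= Y + H].
  elim: n => [|n [i1 i2 i3 i4]]; first by rewrite /= w00 h00 !lexx.
  split; [exact: le_trans (x1 n)|exact: le_trans (x2 n) i2|exact: le_trans (y1 n)|exact: le_trans (y2 n) i4].
pose n := Num.bound ((W + H) / d).
have [m1 m2 m3 m4] := mono n.
apply: (nPs n); apply: loc0 => //.
rewrite /wn /hn -mulrDl ltr_pdivrMr ?exprn_gt0 // mulrC -ltr_pdivrMr //.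
apply: lt_le_trans (archi_boundP _) _; first by rewrite divr_ge0 ?addr_ge0 // ltW.
by rewrite -natrX ler_nat -/n ltnW // ltn_expl.
Qed.

Local Notation pt x y := (rc x + ic * rc y).

(** The integral of G around the rectangle [x1, x2] x [y1, y2], expressed
    through a primitive A ^~ y of G on each horizontal line and a primitive B x
    on each vertical line, for which subdividing the rectangle is additive by
    mere algebra. *)
Definition boundary_integral (A B : R -> R -> C) (x1 x2 y1 y2 : R) : C :=
  (A x2 y1 - A x1 y1) - (A x2 y2 - A x1 y2) + ic * ((B x2 y2 - B x2 y1) - (B x1 y2 - B x1 y1)).

Lemma rder_pt_x (x y : R) : rder (fun x => pt x y) x 1.
Proof.
have := rder_line (ic * rc y) 1 x; apply: der_ext => s; by rewrite mulr1 addrC.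
Qed.

Lemma rder_pt_y (x y : R) : rder (fun y => pt x y) y ic.
Proof.
have := rder_line (rc x) ic y; apply: der_ext => s; by rewrite [rc s * _]mulrC.
Qed.

Lemma mem_subitv X W x w s : X <= x -> x + w <= X + W -> x <= s <= x + w -> X <= s <= X + W.
Proof. by move=> h1 h2 /andP[h3 h4]; rewrite (le_trans h1 h3) (le_trans h4 h2). Qed.

Lemma itv_dist x w p q : x <= p <= x + w -> x <= q <= x + w -> `|p - q| <= w.
Proof. by move=> /andP[h1 h2] /andP[h3 h4]; rewrite ler_norml; lra. Qed.

Lemma left_mem_itv x w : 0 <= w -> x <= x <= x + w. Proof. by move=> w0; rewrite lexx lerDl. Qed.
Lemma right_mem_itv x w : 0 <= w -> x <= x + w <= x + w. Proof. by move=> w0; rewrite lexx lerDl w0. Qed.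

(** Near a point z, G differs from its linear part by e |u - z|, and the linear
    part has the primitive Pp, which contributes nothing to a closed contour. So
    the integral around a small rectangle around z is at most 2 e (w + h)^2, a
    bound that is preserved by gathering four quarters. *)
Lemma goursat (G : C -> C) (A B : R -> R -> C) X Y W H : 0 <= W -> 0 <= H ->
  (forall x y, X <= x <= X + W -> Y <= y <= Y + H ->
     [/\ exists l, cder G (pt x y) l, rder (A ^~ y) x (G (pt x y)) & rder (B x) y (G (pt x y))]) ->
  boundary_integral A B X (X + W) Y (Y + H) = 0.
Proof.
move=> W0 H0 hyp.
suff bnd e : 0 < e -> cmod (boundary_integral A B X (X + W) Y (Y + H)) <= 2 * e * (W + H) ^+ 2.
  apply/eqP; rewrite -cmod_eq0 eq_le cmod_ge0 andbT; apply/ler_addgt0Pr => e e0.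
  rewrite add0r.
  set S := (W + H) ^+ 2 in bnd *; have S0 : 0 <= S by exact: sqr_ge0.
  have k0 : 0 < 2 * (S + 1) by rewrite mulr_gt0 // ltr_wpDl.
  apply: le_trans (bnd _ (divr_gt0 e0 k0)) _.
  have -> : 2 * (e / (2 * (S + 1))) * S = e * (S / (S + 1)).
    by field; rewrite gt_eqF // ltr_wpDl.
  by rewrite ler_piMr ?(ltW e0) // ler_pdivrMr ?ltr_wpDl // mul1r lerDl.
move=> e0.
pose P x y w h := cmod (boundary_integral A B x (x + w) y (y + h)) <= 2 * e * (w + h) ^+ 2.
apply: (@quadrisection P) => //; rewrite /P.
  move=> x y w h p1 p2 p3 p4.
  have -> : boundary_integral A B x (x + w) y (y + h) =
    (boundary_integral A B x (x + w / 2) y (y + h / 2) + boundary_integral A B (x + w / 2) (x + w / 2 + w / 2) y (y + h / 2))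
    + (boundary_integral A B x (x + w / 2) (y + h / 2) (y + h / 2 + h / 2) +
     boundary_integral A B (x + w / 2) (x + w / 2 + w / 2) (y + h / 2) (y + h / 2 + h / 2)).
    rewrite -!addrA -!splitr /boundary_integral; ring.
  have := cmodD (boundary_integral A B x (x + w / 2) y (y + h / 2) + boundary_integral A B (x + w / 2) (x + w / 2 + w / 2) y (y + h / 2))
    (boundary_integral A B x (x + w / 2) (y + h / 2) (y + h / 2 + h / 2) +
     boundary_integral A B (x + w / 2) (x + w / 2 + w / 2) (y + h / 2) (y + h / 2 + h / 2)).
  have := cmodD (boundary_integral A B x (x + w / 2) y (y + h / 2)) (boundary_integral A B (x + w / 2) (x + w / 2 + w / 2) y (y + h / 2)).
  have := cmodD (boundary_integral A B x (x + w / 2) (y + h / 2) (y + h / 2 + h / 2))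
     (boundary_integral A B (x + w / 2) (x + w / 2 + w / 2) (y + h / 2) (y + h / 2 + h / 2)).
  have -> : 2 * e * (w + h) ^+ 2 = 4 * (2 * e * (w / 2 + h / 2) ^+ 2) by field.
  lra.
move=> px py hx hy; set z := pt px py.
have [[l [phi cphi [phil dphi]]] _ _] := hyp px py hx hy.
have /cvg_cmod/(_ _ e0) nphi := cphi.
have /nbhs_cmod[d d0 Hd] : \forall u \near z, G u - G z = phi u * (u - z) /\ cmod (phi u - l) < e.
  by near=> u; split; near: u.
exists d => // x y w h xX xW yY yH hpx hpy whd.
have w0 : 0 <= w by lra.
have h0 : 0 <= h by lra.
have near_z x' y' : x <= x' <= x + w -> y <= y' <= y + h -> cmod (pt x' y' - z) <= w + h.
  move=> hx' hy'; apply: le_trans (cmod_ReIm _) _.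
  have -> : Re (pt x' y' - z) = x' - px by rewrite !ReImE; ring.
  have -> : Im (pt x' y' - z) = y' - py by rewrite !ReImE; ring.
  exact: lerD (itv_dist hx' hpx) (itv_dist hy' hpy).
pose err u := G u - (G z + l * (u - z)).
have err_le x' y' : x <= x' <= x + w -> y <= y' <= y + h -> cmod (err (pt x' y')) <= e * (w + h).
  move=> hx' hy'; have nz := near_z _ _ hx' hy'.
  have [E1 E2] := Hd _ (le_lt_trans nz whd).
  have -> : err (pt x' y') = (phi (pt x' y') - l) * (pt x' y' - z).
    by rewrite mulrBl -E1 /err; ring.
  by rewrite cmodM ler_pM // ?cmod_ge0 // ltW.
(* A primitive of the linear part of G at z. *)
pose Pp u := G z * u + l * 2^-1 * ((u - z) * (u - z)).
have dPp u : cder Pp u (G z + l * (u - z)).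
  have d1 := cderM (der_cst id (G z) u) (cder_id u).
  have d2 := derB (cder_id u) (der_cst id z u).
  have d3 := cderM (der_cst id (l * 2^-1) u) (cderM d2 d2).
  by apply: (der_eq (derD d1 d3)); field.
have eA y' : y <= y' <= y + h ->
    cmod ((A (x + w) y' - Pp (pt (x + w) y')) - (A x y' - Pp (pt x y'))) <= e * (w + h) * w.
  move=> hy'.
  have := @mvt_bound _ (fun s => A s y' - Pp (pt s y')) (fun s => err (pt s y')) x (x + w) (e * (w + h)).
  have -> : x + w - x = w by ring.
  apply; first by rewrite lerDl.
  move=> s hs; split; last exact: err_le.
  have [_ dA _] := hyp s y' (mem_subitv xX xW hs) (mem_subitv yY yH hy').
  apply: derB => //.
  by have := rder_comp (dPp (pt s y')) (rder_pt_x s y'); rewrite mulr1.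
(* On vertical lines the derivative picks up a factor i, hence - i Pp is the
   primitive to compare B x' with. *)
have eB x' : x <= x' <= x + w ->
    cmod ((B x' (y + h) + ic * Pp (pt x' (y + h))) - (B x' y + ic * Pp (pt x' y))) <= e * (w + h) * h.
  move=> hx'.
  have := @mvt_bound _ (fun s => B x' s + ic * Pp (pt x' s)) (fun s => err (pt x' s)) y (y + h) (e * (w + h)).
  have -> : y + h - y = h by ring.
  apply; first by rewrite lerDl.
  move=> s hs; split; last exact: err_le.
  have [_ _ dB] := hyp x' s (mem_subitv xX xW hx') (mem_subitv yY yH hs).
  have d1 := rder_comp (dPp (pt x' s)) (rder_pt_y x' s).
  apply: der_eq; first exact: (derD dB (rderM (der_cst _ ic s) d1)).
  rewrite mul0r add0r mulrCA ic2 mulrN1; rewrite /err; ring.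
have := eA y (left_mem_itv y h0); have := eA (y + h) (right_mem_itv y h0).
have := eB x (left_mem_itv x w0); have := eB (x + w) (right_mem_itv x w0).
set b2 := (X in cmod X <= _ -> _); move=> ub2.
set b1 := (X in cmod X <= _ -> _); move=> ub1.
set a2 := (X in cmod X <= _ -> _); move=> ua2.
set a1 := (X in cmod X <= _ -> _); move=> ua1.
have -> : boundary_integral A B x (x + w) y (y + h) = (a1 - a2) + ic * (b2 - b1).
  apply/eqP; rewrite -subr_eq0; apply/eqP.
  transitivity ((ic * ic + 1) * (Pp (pt (x + w) y) - Pp (pt x y) - Pp (pt (x + w) (y + h)) + Pp (pt x (y + h)))).
    by rewrite /boundary_integral /a1 /a2 /b1 /b2; ring.
  by rewrite ic2 addNr mul0r.
apply: le_trans (cmodD _ _) _; rewrite cmodM cmod_ic mul1r.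
have -> : 2 * e * (w + h) ^+ 2 =
    (e * (w + h) * w + e * (w + h) * w) + (e * (w + h) * h + e * (w + h) * h) by ring.
by apply: lerD; apply: le_trans (cmodB _ _) _; exact: lerD.
Unshelve. all: by end_near. Qed.

End Goursat.

(** * The derivative of a holomorphic function is holomorphic *)
Section Regularity.
Variable R : realType.
Local Notation C := (Cplx R).
Local Notation Re := (@complex.Re R).
Local Notation Im := (@complex.Im R).
Local Notation rc := (@rc R).
Local Notation ic := (@ic R).
Local Notation pt x y := (rc x + ic * rc y).
Implicit Types (x y e r : R) (z u v l : C).

Lemma cexp_pt x y : cexp (pt x y) = rc (expR x) * cis y.
Proof. by rewrite cexpD cexp_rc. Qed.

Lemma min_cst_continuous r : continuous (fun x => Num.min x r).
Proof.
move=> x; apply: (@continuous_min R R (fun x => x) (fun=> r)); first exact: cvg_id.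
exact: cvg_cst.
Qed.

(** In the coordinate u = log (v - z), the punctured disc is a half plane on
    which G u = F (z + e^u) is holomorphic with period 2 i pi. The horizontal
    sides of the rectangle [x0, ln r] x [0, 2 pi] have the same integral of G, so
    by goursat the vertical ones do too: the mean of F over the circle does not
    depend on the radius, and it tends to F z as the radius shrinks. *)
Lemma circle_mean (F : C -> C) (z : C) r r0 : 0 < r < r0 -> F @ z --> F z ->
  (forall u, 0 < cmod (u - z) < r0 -> exists l, cder F u l) ->
  cint (fun s => F (z + rc r * cis s)) (pi *+ 2) = rc (pi *+ 2) * F z.
Proof.
move=> /andP[r_gt0 rr0] cF dF.
have T0 : 0 <= (pi : R) *+ 2 by rewrite mulrn_wge0 // pi_ge0.
pose G u := F (z + cexp u).
have dG u : expR (Re u) <= r -> exists l, cder G u l.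
  move=> ur; have [|l dl] := dF (z + cexp u).
    rewrite addrC addKr cmod_cexp expR_gt0 /=; exact: le_lt_trans ur rr0.
  have d1 : cder (fun u => z + cexp u) u (0 + cexp u) := derD (der_cst id z u) (cder_cexp u).
  by exists (l * (0 + cexp u)); exact (cder_comp (F := F) (f := fun u => z + cexp u) dl d1).
have cG u : expR (Re u) <= r -> G @ u --> G u.
  by move=> /dG[l dl]; exact (cder_cvg dl).
have Rept x y : Re (pt x y) = x by rewrite !ReImE; ring.
have cGy x : x <= ln r -> continuous (fun y => G (pt x y)).
  move=> xr y; have c1 : (fun y => pt x y) @ y --> pt x y := rder_cvg (rder_pt_y x y).
  apply: (at_comp c1); apply: cG; rewrite Rept -(lnK (x := r)) ?posrE //.
  by rewrite ler_expR.
have cGx y : continuous (fun x => G (pt (Num.min x (ln r)) y)).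
  move=> x; have c0 := @min_cst_continuous (ln r) x.
  have c1 : (fun x => pt x y) @ Num.min x (ln r) --> pt (Num.min x (ln r)) y := rder_cvg (rder_pt_x _ y).
  have c2 : (fun x => G (pt x y)) @ Num.min x (ln r) --> G (pt (Num.min x (ln r)) y).
    apply: (at_comp c1); apply: cG.
    rewrite Rept -[leRHS](lnK (x := r)) ?posrE // ler_expR.
    by rewrite ge_min lexx orbT.
  exact (at_comp c0 c2).
have Gper x : G (pt x (pi *+ 2)) = G (pt x 0).
  by rewrite /G !cexp_pt cis_2pi.
pose A x y := cprim (fun x => G (pt (Num.min x (ln r)) y)) x.
pose B x y := cprim (fun y => G (pt x y)) y.
have indep x0 : x0 <= ln r -> cint (fun y => G (pt (ln r) y)) (pi *+ 2) = cint (fun y => G (pt x0 y)) (pi *+ 2).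
  move=> x0r.
  have w0 : 0 <= ln r - x0 by rewrite subr_ge0.
  have := @goursat R G A B x0 0 (ln r - x0) (pi *+ 2) w0 T0.
  rewrite add0r subrKC => H.
  have {H} : boundary_integral A B x0 (ln r) 0 (pi *+ 2) = 0.
    apply: H => x y /andP[_ xr] _; split.
    - apply: dG; rewrite Rept -[leRHS](lnK (x := r)) ?posrE // ler_expR //.
    - have := cprimP (@cGx y) x; rewrite (min_idPl xr); exact.
    - exact (cprimP (@cGy x xr) y).
  rewrite /boundary_integral.
  have -> : A (ln r) 0 = A (ln r) (pi *+ 2).
    by rewrite /A; congr cprim; apply/funext => x; rewrite Gper.
  have -> : A x0 0 = A x0 (pi *+ 2).
    by rewrite /A; congr cprim; apply/funext => x; rewrite Gper.
  rewrite subrr add0r => /eqP; rewrite mulf_eq0 (negbTE (ic_neq0 _)) /=.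
  by rewrite subr_eq0 => /eqP.
have -> : cint (fun s => F (z + rc r * cis s)) (pi *+ 2) = cint (fun y => G (pt (ln r) y)) (pi *+ 2).
  by apply: cint_ext => s; rewrite /G cexp_pt lnK.
apply/eqP; rewrite -subr_eq0 -cmod_eq0 eq_le cmod_ge0 andbT.
apply/ler_addgt0Pr => e e0; rewrite add0r.
have k0 : 0 < e / (pi *+ 2) by rewrite divr_gt0 // mulrn_wgt0 // pi_gt0.
have /cvg_cmod/(_ _ k0)/nbhs_cmod[d d0 Hd] := cF.
pose x0 := Num.min (ln r) (ln (d / 2)).
have x0r : x0 <= ln r by rewrite ge_min lexx.
rewrite (indep x0) // -cint_cst //.
have -> : e = e / (pi *+ 2) * (pi *+ 2).
  by rewrite divfK // gt_eqF // mulrn_wgt0 // pi_gt0.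
apply: (cintB_bound T0).
- exact: cGy.
- move=> s; exact (at_cst _).
move=> s _; apply/ltW/Hd; rewrite cexp_pt addrC addKr cmodM cmod_cis mulr1 cmod_rc.
rewrite ger0_norm ?expR_ge0 //; apply: (@le_lt_trans _ _ (d / 2)); last by lra.
have d2 : 0 < d / 2 by lra.
by rewrite -[leRHS](lnK (x := d / 2)) ?posrE // ler_expR ge_min lexx orbT.
Qed.

Lemma cint_cisN : cint (fun s => (cis s)^-1) (pi *+ 2) = 0 :> C.
Proof.
have T0 : 0 <= (pi : R) *+ 2 by rewrite mulrn_wge0 // pi_ge0.
have E s : (cis s)^-1 = cexp (0 + rc s * (- ic)) :> C.
  by rewrite add0r mulrN cexpN mulrC.
have ch : continuous (fun s => (cis s)^-1 : C).
  by move=> s; exact (atV (cis_neq0 s) (@cis_continuous R s)).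
have -> := @cint_prim R _ (fun s => ic * (cis s)^-1) _ T0 ch.
  by rewrite cis_2pi subrr.
move=> s _; apply: der_eq.
  apply: der_ext (rderM (der_cst rc ic s) (rder_cexp_line 0 (- ic) s)) => y.
  by rewrite E.
by rewrite mul0r add0r -E mulrCA mulrN ic2 opprK mulr1.
Qed.

Section OpenSet.
Variables (D : set C) (F : C -> C).
Hypothesis Dopen : forall z, D z -> exists2 r, 0 < r & forall u, cmod (u - z) < r -> D u.
Hypothesis dF : forall z, D z -> derivable F z 1.
Local Notation F' := (derive1 F).

(** The mean value property of the difference quotient of F at z, which is
    holomorphic off z and takes the value F' z there. *)
Lemma cauchy_derivative (z : C) r r0 : 0 < r < r0 ->
  (forall u, cmod (u - z) < r0 -> D u) ->
  F' z = (rc (pi *+ 2))^-1 * (rc r)^-1 * cint (fun s => F (z + rc r * cis s) * (cis s)^-1) (pi *+ 2).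
Proof.
move=> rr0 zD; have /andP[r_gt0 r_lt] := rr0.
have T0 : 0 <= (pi : R) *+ 2 by rewrite mulrn_wge0 // pi_ge0.
have T1 : rc (pi *+ 2) != 0 by rewrite rc_eq0 gt_eqF // mulrn_wgt0 // pi_gt0.
have Dz : D z by apply: zD; rewrite subrr cmod0; exact: lt_trans r_lt.
pose phi u := if u == z then F' z else (F u - F z) / (u - z).
have phiz : phi z = F' z by rewrite /phi eqxx.
have r0' : rc r != 0 by rewrite rc_eq0 gt_eqF.
have cF (s : R) : (fun s : R => F (z + rc r * cis s)) @ s --> F (z + rc r * cis s).
  have c1 : (fun s => z + rc r * cis s) @ s --> z + rc r * cis s.
    exact (atD (at_cst z) (atM (at_cst (rc r)) (@cis_continuous R s))).
  apply: (at_comp c1); apply: cder_cvg; apply: derivable_cder; apply: dF; apply: zD.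
  by rewrite addrC addKr cmodM cmod_cis mulr1 cmod_rc gtr0_norm.
have cV (s : R) : (fun s : R => (cis s)^-1) @ s --> ((cis s)^-1 : C).
  exact (atV (cis_neq0 s) (@cis_continuous R s)).
have := @circle_mean phi z r r0 rr0.
have -> : cint (fun s => phi (z + rc r * cis s)) (pi *+ 2) =
   (rc r)^-1 * cint (fun s => F (z + rc r * cis s) * (cis s)^-1) (pi *+ 2).
  have -> : cint (fun s => phi (z + rc r * cis s)) (pi *+ 2) =
     cint (fun s => (rc r)^-1 * (F (z + rc r * cis s) * (cis s)^-1 + (- F z) * (cis s)^-1)) (pi *+ 2).
    apply: cint_ext => s; rewrite /phi ifN; last first.
      by rewrite -subr_eq0 addrC addKr mulf_neq0 // cis_neq0.
    have -> : z + rc r * cis s - z = rc r * cis s by ring.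
    by field; rewrite r0' cis_neq0.
  have c1 : continuous (fun s => F (z + rc r * cis s) * (cis s)^-1).
    by move=> s; exact (atM (cF s) (cV s)).
  have c2 : continuous (fun s => - F z * (cis s)^-1).
    by move=> s; exact (atM (at_cst _) (cV s)).
  have c3 : continuous (fun s => F (z + rc r * cis s) * (cis s)^-1 + - F z * (cis s)^-1).
    by move=> s; exact (atD (c1 s) (c2 s)).
  rewrite (cintZ _ T0 c3) (cintD T0 c1 c2) (cintZ _ T0 cV) cint_cisN.
  by rewrite mulr0 addr0.
rewrite phiz => H; rewrite -mulrA H ?mulKf //.
  have [p cp [pz dp]] := derivable_cder (dF Dz).
  apply: at_near cp.
  near=> u; rewrite /phi; case: eqP => [->|/eqP uz]; first by rewrite pz.
  have -> : F u - F z = p u * (u - z) by near: u.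
  by rewrite mulfK // subr_eq0.
move=> u /andP[uz0 uz]; have uz1 : u - z != 0 by rewrite -cmod_gt0.
have d1 := derB (derivable_cder (dF (zD _ uz))) (der_cst id (F z) u).
have d2 := derB (cder_id u) (der_cst id z u).
have d3 := cder_comp (f := fun u => u - z) (cder_inv uz1) d2.
eexists; apply: der_near (cderM d1 d3).
near=> v; rewrite /phi ifN //.
have : cmod (v - u) < cmod (u - z) by near: v; exact: near_cmod.
apply: contraTneq => ->; by rewrite cmodC ltxx.
Unshelve. all: by end_near. Qed.

Lemma disc_in_D (z0 : C) : D z0 -> exists2 r, 0 < r &
  forall z u, cmod (z - z0) < r -> cmod (u - z) < 2 * r -> D u.
Proof.
move=> /Dopen[r r0 H]; exists (r / 3); first by rewrite divr_gt0.
move=> z u h1 h2; apply: H; apply: le_lt_trans (cmod_triangle z _ _) _; lra.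
Qed.

Lemma circle_integrand_cvg (H : C -> C) (z : C) r s : H @ (z + rc r * cis s) --> H (z + rc r * cis s) ->
  (fun p : C * R => H (p.1 + rc r * cis p.2) * (cis p.2)^-1) @ (z, s) --> H (z + rc r * cis s) * (cis s)^-1.
Proof.
move=> cH.
have c1 : (fun p : C * R => p.1) @ (z, s) --> z by exact: cvg_fst.
have c2 : (fun p : C * R => cis p.2) @ (z, s) --> cis s.
  have c2 : (fun p : C * R => p.2) @ (z, s) --> s by exact: cvg_snd.
  exact (at_comp c2 (@cis_continuous R s)).
have c3 := atD c1 (atM (at_cst (rc r)) c2).
exact (atM (at_comp c3 cH) (atV (cis_neq0 s) c2)).
Qed.

Lemma circle_integrand_cont (H : C -> C) (z : C) r :
  (forall s, H @ (z + rc r * cis s) --> H (z + rc r * cis s)) ->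
  continuous (fun s => H (z + rc r * cis s) * (cis s)^-1).
Proof.
move=> cH s.
have c3 := atD (at_cst z) (atM (at_cst (rc r)) (@cis_continuous R s)).
exact (atM (at_comp c3 (cH s)) (atV (cis_neq0 s) (@cis_continuous R s))).
Qed.

(** In cauchy_derivative the radius can be kept fixed while z varies, so F'
    inherits the continuity of F. *)
Lemma derive1_continuous (z0 : C) : D z0 -> F' @ z0 --> F' z0.
Proof.
move=> /disc_in_D[r r0 Hr].
have T0 : 0 <= (pi : R) *+ 2 by rewrite mulrn_wge0 // pi_ge0.
have zz0 : cmod (z0 - z0) < r by rewrite subrr cmod0.
have rr : 0 < r < 2 * r by lra.
have E z : cmod (z - z0) < r -> F' z =
  (rc (pi *+ 2))^-1 * (rc r)^-1 * cint (fun s => F (z + rc r * cis s) * (cis s)^-1) (pi *+ 2).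
  by move=> zz; apply: (cauchy_derivative rr) => u; exact: Hr.
have cF z s : cmod (z - z0) < r -> F @ (z + rc r * cis s) --> F (z + rc r * cis s).
  move=> zz; apply: cder_cvg; apply: derivable_cder; apply: dF; apply: (Hr _ _ zz).
  by rewrite addrC addKr cmodM cmod_cis mulr1 cmod_rc gtr0_norm //; lra.
have ci : (fun z => cint (fun s => F (z + rc r * cis s) * (cis s)^-1) (pi *+ 2)) @ z0 -->
   cint (fun s => F (z0 + rc r * cis s) * (cis s)^-1) (pi *+ 2).
  apply: (@cint_param_cvg R (fun z s => F (z + rc r * cis s) * (cis s)^-1)) => //.
    apply/nbhs_cmod; exists r => // z zz; apply: circle_integrand_cont => s; exact: cF.
  by move=> s _; apply: circle_integrand_cvg; exact: cF.
rewrite (E _ zz0).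
apply: at_near (atM (at_cst ((rc (pi *+ 2))^-1 * (rc r)^-1)) ci).
by near=> z; rewrite E //; near: z; exact: near_cmod.
Unshelve. all: by end_near. Qed.

(** Now that F' is continuous, the formula of cauchy_derivative can be
    differentiated under the integral sign. *)
Lemma derive1_derivable (z0 : C) : D z0 -> derivable F' z0 1.
Proof.
move=> /disc_in_D[r r0 Hr].
have T0 : 0 <= (pi : R) *+ 2 by rewrite mulrn_wge0 // pi_ge0.
have zz0 : cmod (z0 - z0) < r by rewrite subrr cmod0.
have rr : 0 < r < 2 * r by lra.
have E z : cmod (z - z0) < r -> F' z =
  (rc (pi *+ 2))^-1 * (rc r)^-1 * cint (fun s => F (z + rc r * cis s) * (cis s)^-1) (pi *+ 2).
  by move=> zz; apply: (cauchy_derivative rr) => u; exact: Hr.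
have Dc z s : cmod (z - z0) < r -> D (z + rc r * cis s).
  move=> zz; apply: (Hr _ _ zz).
  by rewrite addrC addKr cmodM cmod_cis mulr1 cmod_rc gtr0_norm //; lra.
have cF z s : cmod (z - z0) < r -> F @ (z + rc r * cis s) --> F (z + rc r * cis s).
  by move=> zz; apply: cder_cvg; apply: derivable_cder; apply: dF; exact: Dc.
have ci : cder (fun z => cint (fun s => F (z + rc r * cis s) * (cis s)^-1) (pi *+ 2)) z0
   (cint (fun s => F' (z0 + rc r * cis s) * (cis s)^-1) (pi *+ 2)).
  apply: (@cint_param_der R (fun z s => F (z + rc r * cis s) * (cis s)^-1)
                            (fun z s => F' (z + rc r * cis s) * (cis s)^-1)) => //.
  - apply/nbhs_cmod; exists r => // z zz; apply: circle_integrand_cont => s; exact: cF.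
  - apply: circle_integrand_cont => s; apply: derive1_continuous; exact: Dc.
  - apply/nbhs_cmod; exists r => // z zz s _.
    have d1 := derD (cder_id z) (der_cst id (rc r * cis s) z).
    have d2 := cder_comp (F := F) (f := fun z => z + rc r * cis s) (derivable_cder (dF (Dc _ s zz))) d1.
    apply: (der_eq (cderM d2 (der_cst id (cis s)^-1 z))); ring.
  by move=> s _; apply: circle_integrand_cvg; apply: derive1_continuous; exact: Dc.
have d := cderM (der_cst id ((rc (pi *+ 2))^-1 * (rc r)^-1) z0) ci.
eapply (fun d => (cder_derivable d).1); apply: der_near d.
by near=> z; rewrite E //; near: z; exact: near_cmod.
Unshelve. all: by end_near. Qed.

End OpenSet.
End Regularity.

(** * Lifting through proper local homeomorphisms *)
Section Lifting.
Variable R : realType.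
Local Notation C := (Cplx R).
Local Notation Re := (@complex.Re R).
Local Notation Im := (@complex.Im R).
Local Notation rc := (@rc R).
Local Notation ic := (@ic R).
Implicit Types (x y e r s t a b d : R) (z u v p q l : C) (S U N : set C).

Definition metric_open U := forall z, U z -> exists2 r, 0 < r & forall u, cmod (u - z) < r -> U u.

Lemma open_metric_open U : open U -> metric_open U.
Proof. by rewrite openE => oU z /oU/nbhs_cmod. Qed.

Lemma ball_convex (z u v : C) r t : cmod (u - z) < r -> cmod (v - z) < r ->
  0 <= t <= 1 -> cmod (u + rc t * (v - u) - z) < r.
Proof.
move=> ur vr /andP[t0 t1].
have -> : u + rc t * (v - u) - z = rc (1 - t) * (u - z) + rc t * (v - z).
  by rewrite rcB rc1; ring.
apply: le_lt_trans (cmodD _ _) _; rewrite !cmodM !cmod_rc !ger0_norm ?subr_ge0 //.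
have [->|tn0] := eqVneq t 0; first by rewrite subr0 mul1r mul0r addr0.
have t0' : 0 < t by rewrite lt_def tn0.
apply: (@lt_le_trans _ _ ((1 - t) * r + t * r)); last by rewrite -mulrDl subrK mul1r.
by apply: ler_ltD; [rewrite ler_wpM2l ?subr_ge0 // ltW|rewrite ltr_pM2l].
Qed.

Section LocalInverse.
Variables (U : set C) (F : C -> C).
Hypothesis Uopen : metric_open U.
Hypothesis dF : forall z, U z -> derivable F z 1.
Local Notation F' := (derive1 F).

Lemma strict_diff p e : U p -> 0 < e -> exists2 r, 0 < r &
  (forall u, cmod (u - p) < r -> U u) /\
  forall u v, cmod (u - p) < r -> cmod (v - p) < r ->
    cmod (F u - F v - F' p * (u - v)) <= e * cmod (u - v).
Proof.
move=> Up e0; have [r1 r10 H1] := Uopen Up.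
have /cvg_cmod/(_ _ e0)/nbhs_cmod[r2 r20 H2] := derive1_continuous Uopen dF Up.
exists (Num.min r1 r2); first by rewrite lt_min r10.
split=> [u|u v]; first by rewrite lt_min => /andP[/H1].
rewrite !lt_min => /andP[u1 u2] /andP[v1 v2].
apply: (@segment_bound R F F') => t ht; split.
  by apply/derivable_cder/dF/H1; exact: ball_convex.
by apply/ltW/H2; exact: ball_convex.
Qed.

(** The lower bound k |u - v| makes F injective on the ball. For surjectivity,
    a point q of the closed half ball that minimizes |F q - v| solves F q = v:
    otherwise a small step from q in the direction of (v - F q) / F' p would
    decrease |F q - v|. *)
Lemma local_inverse p : U p -> F' p != 0 ->
  exists k eta delta : R, [/\ [/\ 0 < k, 0 < eta & 0 < delta],
    (forall u, cmod (u - p) < eta -> U u),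
    (forall u v, cmod (u - p) < eta -> cmod (v - p) < eta -> k * cmod (u - v) <= cmod (F u - F v)) &
    (forall v, cmod (v - F p) < delta -> exists2 u, cmod (u - p) < eta & F u = v)].
Proof.
move=> Up; rewrite -cmod_gt0 => l0; set l := F' p in l0 *.
pose k := cmod l / 2; have k0 : 0 < k by rewrite divr_gt0.
have [eta eta0 [etaU str]] := strict_diff Up k0.
have low u v : cmod (u - p) < eta -> cmod (v - p) < eta -> k * cmod (u - v) <= cmod (F u - F v).
  move=> hu hv; have := str _ _ hu hv; rewrite -/l => h.
  have := cmod_rev (l * (u - v)) (l * (u - v) - (F u - F v)).
  rewrite subKr [cmod (l * _ - _)]cmodC cmodM.
  have -> : k * cmod (u - v) = cmod l * cmod (u - v) - k * cmod (u - v).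
    by rewrite /k; field.
  move: h; lra.
exists k, eta, (k * eta / 8); split=> //; first by split=> //; rewrite divr_gt0 // mulr_gt0.
move=> v vp.
pose K := [set u | cmod (u - p) <= eta / 2].
have Kp : K p by rewrite /K /= subrr cmod0; lra.
have KB u : K u -> cmod (u - p) < eta by rewrite /K /=; lra.
pose V := [set cmod (F u - v) | u in K].
have hV : has_inf V by split; [exists (cmod (F p - v)), p|exists 0 => _ [u _ <-]; exact: cmod_ge0].
have /choice[w wP] : forall n : nat, exists u, K u /\ cmod (F u - v) < inf V + n.+1%:R^-1.
  move=> n; have n0 : (0 : R) < n.+1%:R^-1 by rewrite invr_gt0.
  by have [_ [u Ku <-] h] := inf_adherent n0 hV; exists u.
have [|q cq] := @bounded_cluster R w (cmod p + eta / 2).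
  move=> n; have := (wP n).1; rewrite /K /= => h.
  by have := cmodD (w n - p) p; rewrite subrK; lra.
have Kq : K q.
  rewrite /K /=; apply/ler_addgt0Pr => e e0.
  have [n _ h] := cq e e0 0%N; have := (wP n).1; rewrite /K /= => h2.
  have := cmod_triangle (w n) q p; rewrite [cmod (q - w n)]cmodC; lra.
have Fq : cmod (F q - v) <= inf V.
  apply/ler_addgt0Pr => e e0.
  have e2 : 0 < e / 2 by lra.
  have /cvg_cmod/(_ _ e2)/nbhs_cmod[d d0 Hd] := cder_cvg (derivable_cder (dF (etaU _ (KB _ Kq)))).
  have [n Nn h] := cq d d0 (Num.bound (e / 2)^-1).
  have := Hd _ h; have := (wP n).2.
  have : n.+1%:R^-1 < e / 2.
    rewrite -[ltRHS]invrK ltf_pV2 ?posrE ?invr_gt0 //.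
    apply: lt_le_trans (archi_boundP _) _; first by rewrite invr_ge0 ltW.
    by rewrite ler_nat (leq_trans Nn).
  have := cmod_triangle (F (w n)) (F q) v; rewrite [cmod (F q - F (w n))]cmodC.
  move: (n.+1%:R^-1) => i; lra.
have Vle u : K u -> inf V <= cmod (F u - v).
  by move=> Ku; apply: ge_inf; [exact: hV.2|exists u].
have qeta : cmod (q - p) <= eta / 4.
  have h1 := low q p (KB _ Kq) (KB _ Kp).
  have h2 := cmod_triangle v (F q) (F p).
  have h3 := Vle p Kp; rewrite cmodC in h3.
  rewrite -(ler_pM2l k0); apply: le_trans h1 _; move: vp; set ke := k * eta.
  have -> : k * (eta / 4) = ke / 4 by rewrite /ke; ring.
  lra.
exists q; first exact: KB.
apply/eqP; rewrite -subr_eq0 -cmod_eq0; apply: contraT => nz.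
have m0 : 0 < cmod (F q - v) by rewrite lt_def nz cmod_ge0.
have ln0 : l != 0 by rewrite -cmod_gt0.
(* The step is short enough to stay in the half ball, as |q - p| <= eta / 4. *)
pose tau := Num.min 1 (eta / 4 * cmod l / cmod (F q - v)).
have tau0 : 0 < tau by rewrite lt_min ltr01 /= divr_gt0 // mulr_gt0 // divr_gt0.
have tau1 : tau <= 1 by rewrite ge_min lexx.
pose u := q + rc tau * ((v - F q) / l).
have uq : u - q = rc tau * ((v - F q) / l) by rewrite /u; ring.
have cuq : cmod (u - q) = tau * (cmod (F q - v) / cmod l).
  by rewrite uq !cmodM cmodV cmod_rc gtr0_norm // [cmod (v - _)]cmodC.
have Ku : K u.
  rewrite /K /=; have := cmod_triangle q u p.
  have : cmod (u - q) <= eta / 4.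
    rewrite cuq mulrA ler_pdivrMr // -ler_pdivlMr //.
    by rewrite ge_min lexx orbT.
  lra.
have h1 := str u q (KB _ Ku) (KB _ Kq).
have h2 := Vle u Ku.
have h3 := cmodD (F u - F q - l * (u - q)) (F q - v + l * (u - q)).
have E1 : F u - F q - l * (u - q) + (F q - v + l * (u - q)) = F u - v by ring.
have E2 : F q - v + l * (u - q) = rc (1 - tau) * (F q - v).
  by rewrite uq rcB rc1; field.
rewrite E1 E2 cmodM cmod_rc ger0_norm ?subr_ge0 // in h3.
have E3 : k * cmod (u - q) = tau / 2 * cmod (F q - v).
  by rewrite cuq /k; field; rewrite gt_eqF.
rewrite -/l E3 in h1.
have h4 : cmod (F q - v) <= tau / 2 * cmod (F q - v) + (1 - tau) * cmod (F q - v).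
  by apply: le_trans Fq (le_trans h2 (le_trans h3 _)); rewrite lerD2r.
have : tau / 2 * cmod (F q - v) <= 0.
  have -> : tau / 2 * cmod (F q - v) = cmod (F q - v) -
    (tau / 2 * cmod (F q - v) + (1 - tau) * cmod (F q - v)) by field.
  lra.
by rewrite leNgt mulr_gt0 // divr_gt0.
Qed.

End LocalInverse.

(** Divide the factor of E by the factor of F. *)
Lemma cder_implicit (F g E : C -> C) z l m : g @ z --> g z ->
  (\forall u \near z, F (g u) = E u) -> cder F (g z) l -> l != 0 -> cder E z m ->
  cder g z (m / l).
Proof.
move=> cg FgE [p cp [pl dp]] l0 [q cq [qm dq]].
have cpg : (fun u => p (g u)) @ z --> l by exact (at_comp cg cp).
exists (fun u => q u / p (g u)); first exact (atM cq (atV l0 cpg)).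
split; first by rewrite pl qm.
have lp : 0 < cmod l by rewrite cmod_gt0.
have /cvg_cmod/(_ _ lp) np := cpg.
have Ez := nbhs_singleton FgE.
near=> u.
have E1 : F (g u) - F (g z) = p (g u) * (g u - g z) by near: u; exact: (cg _ dp).
have E2 : E u - E z = q u * (u - z) by near: u.
have E3 : F (g u) = E u by near: u.
have p0 : p (g u) != 0.
  have : cmod (p (g u) - l) < cmod l by near: u.
  by apply: contraTneq => ->; rewrite sub0r cmodN ltxx.
by apply: (mulfI p0); rewrite -E1 mulrAC mulrC divfK // -E2 E3 Ez.
Unshelve. all: by end_near. Qed.

Lemma segment_locally_constant (P : R -> Prop) a b : a <= b -> P a ->
  (forall s, a <= s <= b -> exists2 d, 0 < d & forall s' s'', a <= s' <= b -> a <= s'' <= b ->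
     `|s' - s| < d -> `|s'' - s| < d -> P s' -> P s'') -> P b.
Proof.
move=> ab Pa loc.
pose A := [set s | a <= s <= b /\ P s].
have hA : has_sup A.
  by split; [exists a; rewrite /A /= lexx ab|exists b => s [/andP[]]].
have sb : a <= sup A <= b.
  apply/andP; split; first by apply: (sup_upper_bound hA); rewrite /A /= lexx ab.
  by apply: ge_sup; [exact: hA.1|move=> s [/andP[]]].
have [d d0 Hd] := loc _ sb.
have [s [hs Ps] sd] := sup_adherent d0 hA.
have ss : s <= sup A by apply: sup_upper_bound.
have sd' : `|s - sup A| < d by rewrite ltr_norml; lra.
have [bs|bs] := ltP b (sup A + d).
  by apply: (Hd s b) => //; [rewrite lexx ab|rewrite ltr_norml; lra].
have : sup A + d / 2 <= sup A.
  apply: sup_upper_bound => //; split; first lra.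
  by apply: (Hd s) => //; [lra|rewrite ltr_norml; lra].
lra.
Qed.

Section Lifts.
Variables (U : set C) (F : C -> C).
Hypothesis Uopen : metric_open U.
Hypothesis dF : forall z, U z -> derivable F z 1.
Hypothesis F'_neq0 : forall z, U z -> derive1 F z != 0.

(** The set where two lifts of a path agree is open because F is locally
    injective, and its complement is open by continuity. *)
Lemma path_unique (c1 c2 : R -> C) a b : a <= b ->
  (forall s, a <= s <= b -> [/\ U (c1 s), F (c1 s) = F (c2 s), c1 @ s --> c1 s & c2 @ s --> c2 s]) ->
  c1 a = c2 a -> c1 b = c2 b.
Proof.
move=> ab H E0; apply: (@segment_locally_constant (fun s => c1 s = c2 s) a b ab E0) => s hs.
have [Us Fs k1 k2] := H s hs.
have [E|N] := eqVneq (c1 s) (c2 s).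
  have [k [eta [delta [[k0 eta0 _] _ low _]]]] := local_inverse Uopen dF Us (F'_neq0 Us).
  have /cvg_cmod/(_ _ eta0) n1 := k1.
  have /cvg_cmod/(_ _ eta0) n2 := k2.
  have /nbhs_real[d d0 Hd] : \forall s' \near s, cmod (c1 s' - c1 s) < eta /\ cmod (c2 s' - c2 s) < eta.
    by near=> s'; split; near: s'.
  exists d => // s' s'' _ hs'' _ /Hd[h1 h2] _.
  rewrite -E in h2; have := low _ _ h1 h2.
  have [_ -> _ _] := H s'' hs''; rewrite subrr cmod0 pmulr_rle0 // => h.
  by apply/eqP; rewrite -subr_eq0 -cmod_eq0 eq_le h cmod_ge0.
have m0 : 0 < cmod (c1 s - c2 s) / 2 by rewrite divr_gt0 // cmod_gt0 subr_eq0.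
have /cvg_cmod/(_ _ m0) n1 := k1.
have /cvg_cmod/(_ _ m0) n2 := k2.
have /nbhs_real[d d0 Hd] : \forall s' \near s, cmod (c1 s' - c1 s) < cmod (c1 s - c2 s) / 2 /\
    cmod (c2 s' - c2 s) < cmod (c1 s - c2 s) / 2.
  by near=> s'; split; near: s'.
exists d => // s' s'' hs' _ /Hd[h1 h2] _ E; exfalso.
have := cmod_triangle (c1 s') (c1 s) (c2 s); rewrite [cmod (c1 s - c1 s')]cmodC {2}E; lra.
Unshelve. all: by end_near. Qed.

Variables (S : set C) (E : C -> C).
Hypothesis Sopen : metric_open S.
Definition is_convex N := forall u v t, N u -> N v -> 0 <= t <= 1 -> N (u + rc t * (v - u)).
Hypothesis Sconvex : is_convex S.
Hypothesis E_cont : forall z, S z -> E @ z --> E z.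
(** Properness of F over the range of E, near z: points of U that F maps to
    values of E near z have a cluster point in U. *)
Hypothesis F_proper : forall z, S z -> exists2 r, 0 < r & forall qn : nat -> C,
  (forall n, U (qn n) /\ exists2 u, cmod (u - z) < r & F (qn n) = E u) ->
  exists2 q, U q & forall e, 0 < e -> forall m : nat, exists2 n, (m <= n)%N & cmod (qn n - q) < e.

Definition lift_on N (g : C -> C) := forall z, N z -> [/\ U (g z), F (g z) = E z & g @ z --> g z].

Lemma line_cvg u v t : (fun t => u + rc t * v) @ t --> u + rc t * v.
Proof. exact: (rder_cvg (rder_line u v t)). Qed.

Lemma lift_unique N (g1 g2 : C -> C) u v : is_convex N -> lift_on N g1 -> lift_on N g2 ->
  N u -> g1 u = g2 u -> N v -> g1 v = g2 v.
Proof.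
move=> cN l1 l2 Nu e Nv.
have := @path_unique (fun t => g1 (u + rc t * (v - u))) (fun t => g2 (u + rc t * (v - u))) 0 1 ler01.
rewrite rc0 rc1 mul0r mul1r addr0 subrKC; apply; last exact e.
move=> t ht.
have Nt := cN _ _ _ Nu Nv ht.
have [h1 h2 h3] := l1 _ Nt; have [k1 k2 k3] := l2 _ Nt.
have cl := @line_cvg u (v - u) t.
by split; [exact h1|rewrite h2 k2|exact (at_comp cl h3)|exact (at_comp cl k3)].
Qed.

(** The radius r serves all the points q above the ball: otherwise points q_n
    for which the radius 1 / (n + 1) fails would cluster at some q in U, near
    which F has a local inverse. *)
Lemma evenly_covered z1 : S z1 -> exists2 r, 0 < r &
  (forall z, cmod (z - z1) < r -> S z) /\
  forall z q, cmod (z - z1) < r -> U q -> F q = E z ->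
    exists2 h, lift_on [set u | cmod (u - z1) < r] h & h z = q.
Proof.
move=> Sz1; have [r1 r10 Sr1] := Sopen Sz1; have [r2 r20 prop] := F_proper Sz1.
pose r0 := Num.min r1 r2; have r00 : 0 < r0 by rewrite lt_min r10.
have Sr0 z : cmod (z - z1) < r0 -> S z by rewrite lt_min => /andP[/Sr1].
apply: contrapT => nex.
have rn0 (n : nat) : 0 < Num.min r0 n.+1%:R^-1 by rewrite lt_min r00 invr_gt0 ltr0n.
have /choice[zq zqP] : forall n : nat, exists zq : C * C,
   [/\ cmod (zq.1 - z1) < Num.min r0 n.+1%:R^-1, U zq.2, F zq.2 = E zq.1 &
   ~ exists2 h, lift_on [set u | cmod (u - z1) < Num.min r0 n.+1%:R^-1] h & h zq.1 = zq.2].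
  move=> n; apply: contrapT => H; apply: nex; exists (Num.min r0 n.+1%:R^-1) => //; split.
    by move=> z; rewrite lt_min => /andP[/Sr0].
  move=> z q zr Uq Fq; apply: contrapT => H1; apply: H; by exists (z, q).
have rle n : Num.min r0 n.+1%:R^-1 <= n.+1%:R^-1 by rewrite ge_min lexx orbT.
have rle0 n : Num.min r0 n.+1%:R^-1 <= r0 by rewrite ge_min lexx.
have [n|q Uq cq] := prop (fun n => (zq n).2).
  have [h h1 h2 _] := zqP n; split=> //; exists (zq n).1 => //.
  by apply: lt_le_trans (lt_le_trans h (rle0 n)) _; rewrite ge_min lexx orbT.
have small d : 0 < d -> forall n, (Num.bound d^-1 <= n)%N -> n.+1%:R^-1 < d :> R.
  move=> d0 n Nn; rewrite -[ltRHS]invrK ltf_pV2 ?posrE ?invr_gt0 //.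
  apply: lt_le_trans (archi_boundP _) _; first by rewrite invr_ge0 ltW.
  by rewrite ler_nat (leq_trans Nn).
have Fq : F q = E z1.
  apply/eqP; rewrite -subr_eq0 -cmod_eq0 eq_le cmod_ge0 andbT.
  apply/ler_addgt0Pr => e e0; rewrite add0r.
  have e2 : 0 < e / 2 by lra.
  have /cvg_cmod/(_ _ e2)/nbhs_cmod[d1 d10 H1] := cder_cvg (derivable_cder (dF Uq)).
  have /cvg_cmod/(_ _ e2)/nbhs_cmod[d2 d20 H2] := E_cont Sz1.
  have [n Nn h] := cq d1 d10 (Num.bound d2^-1).
  have [k1 _ k2 _] := zqP n.
  have := H1 _ h; rewrite k2 => k3.
  have := H2 _ (lt_trans (lt_le_trans k1 (rle n)) (small _ d20 _ Nn)) => k4.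
  have := cmod_triangle (E (zq n).1) (F q) (E z1); rewrite [cmod (F q - E (zq n).1)]cmodC; lra.
have [k [eta [delta [[k0 eta0 delta0] etaU low sur]]]] := local_inverse Uopen dF Uq (F'_neq0 Uq).
have /cvg_cmod/(_ _ delta0)/nbhs_cmod[d d0 Hd] := E_cont Sz1.
have [n Nn qn] := cq eta eta0 (Num.bound d^-1).
have [zn Un Fn nlift] := zqP n; apply: nlift.
set rn := Num.min r0 n.+1%:R^-1 in zn *.
have rnd : rn <= d by apply: le_trans (rle n) _; apply/ltW/small.
have Sn u : cmod (u - z1) < rn -> S u by move=> h; apply: Sr0; exact: lt_le_trans h (rle0 n).
pose h u := xget q [set v | cmod (v - q) < eta /\ F v = E u].
have hP u : cmod (u - z1) < rn -> cmod (h u - q) < eta /\ F (h u) = E u.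
  move=> ur; rewrite /h; case: xgetP => [v _ //|nv].
  have [|v v1 v2] := sur (E u); first by rewrite Fq; apply: Hd; exact: lt_le_trans ur rnd.
  by have := nv v; case.
exists h.
  move=> u /= ur; have [h1 h2] := hP u ur; split; [exact: etaU|exact h2|].
  apply/cvg_cmod => e e0.
  have ke : 0 < k * e by rewrite mulr_gt0.
  have /cvg_cmod/(_ _ ke) nE := E_cont (Sn _ ur).
  have ur' : 0 < rn - cmod (u - z1) by rewrite subr_gt0.
  near=> v; have vr : cmod (v - z1) < rn.
    have : cmod (v - u) < rn - cmod (u - z1) by near: v; exact: near_cmod.
    have := cmod_triangle u v z1; lra.
  have [h3 h4] := hP v vr.
  rewrite -(ltr_pM2l k0); apply: le_lt_trans (low _ _ h3 h1) _.
  by rewrite h4 h2; near: v.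
have [h1 h2] := hP _ zn.
have := low _ _ h1 qn; rewrite h2 Fn subrr cmod0 pmulr_rle0 // => h3.
by apply/eqP; rewrite -subr_eq0 -cmod_eq0 eq_le h3 cmod_ge0.
Unshelve. all: by end_near. Qed.

Section Segment.
Variables (z0 q0 z : C).
Hypotheses (Sz0 : S z0) (Uq0 : U q0) (Fq0 : F q0 = E z0) (Sz : S z).

(** Tubes around segments are convex, so lifts on them are determined by their
    value at z0. *)
Definition tube s e := [set u | S u /\ exists2 r, 0 <= r <= s & cmod (u - (z0 + rc r * (z - z0))) < e].

Lemma tube_convex s e : 0 < e -> is_convex (tube s e).
Proof.
move=> e0 u v t [Su [r1 hr1 h1]] [Sv [r2 hr2 h2]] ht; split; first exact: Sconvex.
have /andP[t0 t1] := ht; have /andP[r10 r11] := hr1; have /andP[r20 r21] := hr2.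
exists ((1 - t) * r1 + t * r2).
  apply/andP; split; first by rewrite addr_ge0 // mulr_ge0 // subr_ge0.
  apply: (@le_trans _ _ ((1 - t) * s + t * s)).
    by rewrite lerD // ler_wpM2l // subr_ge0.
  by rewrite -mulrDl subrK mul1r.
have := @ball_convex 0 (u - (z0 + rc r1 * (z - z0))) (v - (z0 + rc r2 * (z - z0))) e t.
rewrite !subr0 => /(_ h1 h2 ht); congr (cmod _ < _).
by rewrite rcD !rcM rcB rc1; ring.
Qed.

Lemma tube_open s e : metric_open (tube s e).
Proof.
move=> u [Su [r hr h]]; have [d d0 Hd] := Sopen Su.
exists (Num.min d (e - cmod (u - (z0 + rc r * (z - z0))))).
  by rewrite lt_min d0 subr_gt0.
move=> v; rewrite lt_min => /andP[v1 v2]; split; first exact: Hd.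
exists r => //; have := cmod_triangle u v (z0 + rc r * (z - z0)); lra.
Qed.

(** Carrying a lift along the segment: over an evenly covered ball it extends
    forwards by gluing, so the existence of a lift around the part up to s is a
    locally constant property of s. *)
Lemma lift_tube : exists2 e, 0 < e & exists2 g, lift_on (tube 1 e) g & g z0 = q0.
Proof.
pose gam r := z0 + rc r * (z - z0).
have gamS r : 0 <= r <= 1 -> S (gam r) by exact: Sconvex.
have tz0 s e : 0 <= s -> 0 < e -> tube s e z0.
  move=> s0 e0; split=> //; exists 0; first by rewrite lexx.
  by rewrite rc0 mul0r addr0 subrr cmod0.
apply: (@segment_locally_constant (fun s => exists2 e, 0 < e & exists2 g, lift_on (tube s e) g & g z0 = q0) 0 1) => //.
  have [r r0 [rS cov]] := evenly_covered Sz0.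
  have [|h lh hz0] := cov z0 q0 _ Uq0 Fq0; first by rewrite subrr cmod0.
  exists r => //; exists h => // u [Su [r1 hr1 ur]]; apply: lh => /=.
  have r10 : r1 = 0 by lra.
  by move: ur; rewrite r10 rc0 mul0r addr0.
move=> s hs; have [rho rho0 [rhoS cov]] := evenly_covered (gamS _ hs).
have m1 : 0 < cmod (z - z0) + 1 by rewrite ltr_wpDl // cmod_ge0.
pose d := rho / 2 / (cmod (z - z0) + 1).
have d0 : 0 < d by rewrite !divr_gt0.
have gam_near r : `|r - s| < d -> cmod (gam r - gam s) < rho / 2.
  move=> rs; have -> : gam r - gam s = rc (r - s) * (z - z0) by rewrite /gam rcB; ring.
  rewrite cmodM cmod_rc; apply: (@le_lt_trans _ _ (`|r - s| * (cmod (z - z0) + 1))).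
    by rewrite ler_wpM2l // lerDl.
  by rewrite -ltr_pdivlMr.
exists d => // s' s'' hs' hs'' s's s''s [e e0 [g lg gz0]].
have ts' : tube s' e (gam s').
  split; first exact: gamS.
  exists s'; first by rewrite lexx andbT; case/andP: hs'.
  by rewrite subrr cmod0.
have [Ug Fg _] := lg _ ts'.
have gr : cmod (gam s' - gam s) < rho by have := gam_near _ s's; lra.
have [h lh hs'g] := cov _ _ gr Ug Fg.
have agree u : tube s' e u -> cmod (u - gam s) < rho -> g u = h u.
  move=> tu ur.
  apply: (@lift_unique (tube s' e `&` [set u | cmod (u - gam s) < rho]) g h (gam s')) => //.
  - move=> u1 u2 t [t1 b1] [t2 b2] ht; split; first exact: tube_convex.
    exact: ball_convex.
  - by move=> v [/lg].
  - by move=> v [_ /lh].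
exists (Num.min e (rho / 2)); first by rewrite lt_min e0 /= divr_gt0.
exists (fun u => if `[< tube s' e u >] then g u else h u); last first.
  by rewrite asboolT //; apply: tz0 => //; case/andP: hs'.
have cover u : tube s'' (Num.min e (rho / 2)) u -> ~ tube s' e u -> cmod (u - gam s) < rho.
  move=> [Su [r /andP[r0 rs''] ur]] nt; move: ur; rewrite lt_min => /andP[ur1 ur2].
  have rs' : s' < r.
    rewrite ltNge; apply/negP => h1; apply: nt; split=> //.
    by exists r => //; rewrite r0.
  have : `|r - s| < d by move: s's s''s; rewrite !ltr_norml; lra.
  move=> /gam_near; have := cmod_triangle (gam r) u (gam s); rewrite -/(gam r) in ur2; lra.
move=> u tu; have [tu'|tu'] := pselect (tube s' e u).
  have [h1 h2 h3] := lg _ tu'; rewrite (asboolT tu'); split; [exact h1|exact h2|].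
  apply: at_near h3; have [r r0 Hr] := tube_open tu'.
  by apply/nbhs_cmod; exists r => // v /Hr tv; rewrite asboolT.
have ur := cover _ tu tu'.
have [h1 h2 h3] := lh _ ur; rewrite (asboolF tu'); split; [exact h1|exact h2|].
apply: at_near h3; apply/nbhs_cmod; exists (rho - cmod (u - gam s)); first by rewrite subr_gt0.
move=> v vu; have vr : cmod (v - gam s) < rho by have := cmod_triangle u v (gam s); lra.
case: asboolP => // tv; exact/esym/agree.
Qed.

End Segment.

(** Monodromy over a convex set: the lifts along the segments issued from z0
    agree near each other, since two tubes meet in a convex set. *)
Theorem lift_exists z0 q0 : S z0 -> U q0 -> F q0 = E z0 ->
  exists2 g, lift_on S g & g z0 = q0.
Proof.
move=> Sz0 Uq0 Fq0.
have /choice[eg egP] : forall z, exists eg : R * (C -> C), S z ->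
    [/\ 0 < eg.1, lift_on (tube z0 z 1 eg.1) eg.2 & eg.2 z0 = q0].
  move=> z; have [Sz|nS] := pselect (S z); last by exists (0, id).
  by have [e e0 [g lg gz]] := lift_tube Sz0 Uq0 Fq0 Sz; exists (e, g).
have t0 z e : 0 < e -> tube z0 z 1 e z0.
  move=> e0; split=> //; exists 0; first by rewrite lexx ler01.
  by rewrite rc0 mul0r addr0 subrr cmod0.
have t1 z e : 0 < e -> S z -> tube z0 z 1 e z.
  move=> e0 Sz; split=> //; exists 1; first by rewrite lexx ler01.
  by rewrite rc1 mul1r subrKC subrr cmod0.
exists (fun z => (eg z).2 z); last by have [] := egP z0 Sz0.
move=> z Sz; have [e0 lg gz] := egP z Sz.
have [h1 h2 h3] := lg _ (t1 _ _ e0 Sz); split; [exact h1|exact h2|].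
apply: at_near h3; have [r r0 Hr] := tube_open (t1 _ _ e0 Sz).
apply/nbhs_cmod; exists r => // u /Hr tu.
have Su : S u by case: tu.
have [e0' lg' gz'] := egP u Su.
apply: (@lift_unique (tube z0 z 1 (eg z).1 `&` tube z0 u 1 (eg u).1) _ _ z0).
- by move=> u1 u2 t [a1 b1] [a2 b2] ht; split; exact: tube_convex.
- by move=> v [/lg].
- by move=> v [_ /lg'].
- by split; exact: t0.
- by rewrite gz gz'.
- by split=> //; exact: t1.
Qed.

End Lifts.
End Lifting.

(** * The exponential map *)
Section ExpCovering.
Variable R : realType.
Local Notation C := (Cplx R).
Local Notation Re := (@complex.Re R).
Local Notation Im := (@complex.Im R).
Local Notation rc := (@rc R).
Local Notation ic := (@ic R).
Implicit Types (x y e r s t d : R) (z u v p q l : C) (k m : int).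
Local Notation tau := ((pi : R) *+ 2).

Lemma tau_gt0 : 0 < tau. Proof. by rewrite mulrn_wgt0 // pi_gt0. Qed.

Lemma cos_periodic y k : cos (y + tau * k%:~R) = cos y.
Proof.
case: k => n.
  by rewrite -[n%:~R]/(n%:R) mulr_natr periodicn //; exact: cosD2pi.
rewrite NegzE mulrNz mulrN -[n.+1%:~R]/(n.+1%:R) mulr_natr.
by have := periodicn (@cosD2pi R) n.+1 (y - tau *+ n.+1); rewrite subrK.
Qed.

Lemma cos_eq1 y : cos y = 1 -> exists k : int, y = tau * k%:~R.
Proof.
move=> cy; pose k := Num.floor (y / tau).
have /andP[k1 k2] := floor_itv (y / tau); rewrite -/k in k1 k2.
pose r := y - tau * k%:~R.
have r0 : 0 <= r by rewrite subr_ge0 mulrC -ler_pdivlMr ?tau_gt0.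
have r1 : r < tau.
  rewrite ltrBlDr; move: k2; rewrite ltr_pdivrMr ?tau_gt0 // intrD mulrDl mul1r.
  by rewrite addrC mulrC.
have cr : cos r = 1 by rewrite -(cos_periodic r k) subrK.
exists k; apply/eqP; rewrite -subr_eq0 -/r.
have [rpi|rpi] := leP r pi.
  by apply/eqP; apply: cos_inj; rewrite ?in_itv /= ?r0 ?lexx ?pi_ge0 // cr cos0.
have c2 : cos (tau - r) = 1 by rewrite addrC cosD2pi cosN.
have h : tau - r = 0.
  apply: cos_inj; rewrite ?in_itv /= ?lexx ?pi_ge0 ?c2 ?cos0 //.
  by move: r1 rpi; rewrite mulr2n; lra.
lra.
Qed.

Lemma cexp_eq z u : cexp z = cexp u -> exists k : int, z = u + ic * rc (tau * k%:~R).
Proof.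
move=> E.
have E1 : cexp (z - u) = 1 by rewrite cexpD cexpN E divff // cexp_neq0.
have r0 : Re (z - u) = 0.
  apply: (@expR_inj R); rewrite expR0 -(cmod1 R) -E1; exact/esym/cmod_cexp.
have [k hk] : exists k : int, Im (z - u) = tau * k%:~R.
  apply: cos_eq1; have := congr1 Re E1.
  by rewrite Re_cexp r0 expR0 mul1r.
exists k; rewrite -hk -[LHS](subrK u) {1}(ReIm (z - u)) r0 rc0 add0r addrC //.
Qed.

Lemma cexp_shift z k : cexp (z + ic * rc (tau * k%:~R)) = cexp z.
Proof.
rewrite cexpD.
suff -> : cexp (ic * rc (tau * k%:~R)) = 1 by rewrite mulr1.
have c1 : cos (tau * k%:~R) = 1 by rewrite -[_ * _]add0r cos_periodic cos0.
have s0 : sin (tau * k%:~R) = 0.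
  have := cos2Dsin2 (tau * k%:~R); rewrite c1 expr1n => h.
  by apply/eqP; rewrite -sqrf_eq0; apply/eqP; lra.
have e1 : Re (ic * rc (tau * k%:~R)) = 0 by rewrite !ReImE; ring.
have e2 : Im (ic * rc (tau * k%:~R)) = tau * k%:~R by rewrite !ReImE; ring.
by apply: complex_ext; rewrite ?Re_cexp ?Im_cexp e1 e2 expR0 ?c1 ?s0 ?mulr1 ?mulr0.
Qed.

Lemma cexp_surj z : z != 0 -> exists u, cexp u = z.
Proof.
move=> z0; have m0 : 0 < cmod z by rewrite cmod_gt0.
pose c := Re z / cmod z; pose s := Im z / cmod z.
have cs : c ^+ 2 + s ^+ 2 = 1.
  rewrite /c /s !expr_div_n -mulrDl -sqr_cmod divff // expf_neq0 // gt_eqF //.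
have c1 : -1 <= c <= 1.
  rewrite -ler_norml -(@ler_pXn2r R 2) ?nnegrE // real_normK ?num_real // expr1n.
  by have := sqr_ge0 s; lra.
have [t [ct st]] : exists t, cos t = c /\ sin t = s.
  have sE : Num.sqrt (1 - c ^+ 2) = `|s|.
    by have -> : 1 - c ^+ 2 = s ^+ 2; [lra|rewrite sqrtr_sqr].
  have [s0|s0] := leP 0 s.
    exists (acos c); rewrite acosK ?in_itv //=; split=> //.
    by rewrite sin_acos // sE ger0_norm.
  exists (- acos c); rewrite cosN sinN acosK ?in_itv //=; split=> //.
  by rewrite sin_acos // sE ltr0_norm // opprK.
exists (rc (ln (cmod z)) + ic * rc t).
have e1 : Re (rc (ln (cmod z)) + ic * rc t) = ln (cmod z) by rewrite !ReImE; ring.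
have e2 : Im (rc (ln (cmod z)) + ic * rc t) = t by rewrite !ReImE; ring.
apply: complex_ext; rewrite ?Re_cexp ?Im_cexp e1 e2 lnK ?posrE //.
  by rewrite ct /c mulrC divfK // gt_eqF.
by rewrite st /s mulrC divfK // gt_eqF.
Qed.

Lemma metric_openT : metric_open [set: C].
Proof. by move=> z _; exists 1. Qed.

Lemma derive1_cexp z : derive1 (@cexp R) z = cexp z.
Proof. exact: (cder_derivable (cder_cexp z)).2. Qed.

Lemma derivable_cexp z : derivable (@cexp R) z 1.
Proof. exact: (cder_derivable (cder_cexp z)).1. Qed.

Lemma ln_cmod_cexp u : ln (cmod (cexp u)) = Re u.
Proof. by rewrite cmod_cexp expRK. Qed.

(** The exponential and F both have local inverses, so their lift is open. *)
Lemma lift_open (U N : set C) (F h : C -> C) z :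
  metric_open U -> (forall z, U z -> derivable F z 1) -> (forall z, U z -> derive1 F z != 0) ->
  metric_open N -> lift_on U F (@cexp R) N h -> N z ->
  exists2 r, 0 < r & forall p, cmod (p - h z) < r -> exists2 u, N u & h u = p.
Proof.
move=> oU dF F0 oN lh Nz; have [Uhz Fhz ch] := lh _ Nz.
have [k [eta [delta [[k0 eta0 delta0] etaU low sur]]]] := local_inverse oU dF Uhz (F0 _ Uhz).
have /cvg_cmod/(_ _ eta0)/nbhs_cmod[d1 d10 H1] := ch.
have [d2 d20 H2] := oN _ Nz.
have e0 : derive1 (@cexp R) z != 0 by rewrite derive1_cexp cexp_neq0.
have [k' [eta' [delta' [[k'0 eta'0 delta'0] _ low' sur']]]] :=
  local_inverse metric_openT (fun z _ => @derivable_cexp z) I e0.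
pose d := Num.min d1 d2; have d0 : 0 < d by rewrite lt_min d10.
have m0 : 0 < Num.min delta' (k' * d) by rewrite lt_min delta'0 mulr_gt0.
have /cvg_cmod/(_ _ m0)/nbhs_cmod[d3 d30 H3] := cder_cvg (derivable_cder (dF _ Uhz)).
exists (Num.min eta d3); first by rewrite lt_min eta0.
move=> p; rewrite lt_min => /andP[p1 /H3]; rewrite Fhz lt_min => /andP[/sur'[u u1 u2] h2].
have ud : cmod (u - z) < d.
  rewrite -(ltr_pM2l k'0); apply: le_lt_trans h2; rewrite -u2; apply: low' => //.
  by rewrite subrr cmod0.
move: ud; rewrite lt_min => /andP[ud1 ud2].
exists u; first exact: H2.
have [_ Fhu _] := lh _ (H2 _ ud2).
have := low _ _ (H1 _ ud1) p1; rewrite Fhu u2 subrr cmod0 pmulr_rle0 // => h3.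
by apply/eqP; rewrite -subr_eq0 -cmod_eq0 eq_le h3 cmod_ge0.
Qed.

End ExpCovering.

(** * Uniformization of a regular lemniscate region *)
Section Uniformization.
Variable R : realType.
Local Notation C := (Cplx R).
Local Notation Re := (@complex.Re R).
Local Notation Im := (@complex.Im R).
Local Notation rc := (@rc R).
Local Notation ic := (@ic R).
Local Notation tau := ((pi : R) *+ 2).

Lemma ereal_itv_inner (a b : \bar R) (t : R) : (a < t%:E < b)%E ->
  exists t1 t2 : R, [/\ t1 < t, t < t2, (a < t1%:E)%E & (t2%:E < b)%E].
Proof.
move=> /andP[at_ tb].
have [t1 [h1 h2]] : exists t1 : R, t1 < t /\ (a < t1%:E)%E.
  case: a at_ => [a||] //= at_.
    by exists ((a + t) / 2); move: at_; rewrite !lte_fin; lra.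
  by exists (t - 1); rewrite ltNyr; split => //; lra.
have [t2 [h3 h4]] : exists t2 : R, t < t2 /\ (t2%:E < b)%E.
  case: b tb => [b||] //= tb.
    by exists ((b + t) / 2); move: tb; rewrite !lte_fin; lra.
  by exists (t + 1); rewrite ltry; split => //; lra.
by exists t1, t2.
Qed.

Section Strip.
Variables (a b : \bar R).

Lemma strip_open : metric_open (strip a b).
Proof.
move=> z /ereal_itv_inner[t1 [t2 [h1 h2 h3 h4]]].
exists (Num.min (Re z - t1) (t2 - Re z)); first by rewrite lt_min !subr_gt0 h1.
move=> u; rewrite lt_min => /andP[u1 u2].
have := Re_cmod (u - z); rewrite !ReImE ler_norml => /andP[r1 r2].
rewrite /strip /=; apply/andP; split.
  by apply: lt_trans h3 _; rewrite lte_fin; lra.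
by apply: lt_trans h4; rewrite lte_fin; lra.
Qed.

Lemma strip_convex : is_convex (strip a b).
Proof.
move=> u v t /andP[u1 u2] /andP[v1 v2] /andP[t0 t1].
have E : Re (u + rc t * (v - u)) = (1 - t) * Re u + t * Re v by rewrite !ReImE; ring.
rewrite /strip /= E; apply/andP; split.
  apply: (@lt_le_trans _ _ (Num.min (Re u) (Re v))%:E); first by rewrite minEle; case: ifP.
  rewrite lee_fin.
  have m1 : Num.min (Re u) (Re v) <= Re u by rewrite ge_min lexx.
  have m2 : Num.min (Re u) (Re v) <= Re v by rewrite ge_min lexx orbT.
  set M := Num.min (Re u) (Re v) in m1 m2 *; have -> : M = (1 - t) * M + t * M by ring.
  by rewrite lerD // ler_wpM2l // subr_ge0.
apply: (@le_lt_trans _ _ (Num.max (Re u) (Re v))%:E); last by rewrite maxEle; case: ifP.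
rewrite lee_fin.
have m1 : Re u <= Num.max (Re u) (Re v) by rewrite le_max lexx.
have m2 : Re v <= Num.max (Re u) (Re v) by rewrite le_max lexx orbT.
set M := Num.max (Re u) (Re v) in m1 m2 *; have -> : M = (1 - t) * M + t * M by ring.
by rewrite lerD // ler_wpM2l // subr_ge0.
Qed.

Lemma strip_shift z y : strip a b z -> strip a b (z + ic * rc y).
Proof. by rewrite /strip /= !ReImE mul0r mul1r subr0 addr0. Qed.

End Strip.

Variables (D U : set C) (f : C -> C) (a b : \bar R).
Hypothesis hU : regular_lemniscate_region D U f a b.
Local Notation S := (strip a b).
Implicit Types (x y e r s t d : R) (z u v p q l : C) (k m : int).

Lemma U_band z : U z -> [/\ D z /\ f z != 0, derive1 f z != 0, derivable f z 1,
  lnmod f z = (ln (cmod (f z)))%:E & (a < (ln (cmod (f z)))%:E < b)%E].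
Proof.
move=> Uz; have [[oD anf ab [z0 Ez0 EU] _] reg] := hU.
have := reg z Uz; rewrite mulf_eq0 negb_or => /andP[fz f'z].
have : level_band D f a b z.
  by move: Uz; rewrite EU; exact: connected_component_sub.
have lE : lnmod f z = (ln (cmod (f z)))%:E by rewrite /lnmod lne_EFin // cmod_gt0.
by case=> Dz; rewrite /= lE => h; split=> //; exact: anf.
Qed.

(** Points of the band near p are joined to p by segments in the band, and U is
    a connected component of the band. *)
Lemma U_open : metric_open U.
Proof.
move=> p Up; have [[oD anf ab [z0 Ez0 EU] _] reg] := hU.
have [[Dp fp] f'p dp lp lab] := U_band Up.
have [t1 [t2 [h1 h2 h3 h4]]] := ereal_itv_inner lab.
have [r0 r00 HD] := open_metric_open oD Dp.
have cf : (fun z => cmod (f z)) @ p --> cmod (f p).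
  exact (at_cmod (cder_cvg (derivable_cder dp))).
have fp0 : 0 < cmod (f p) by rewrite cmod_gt0.
have e1 : expR t1 < cmod (f p) by rewrite -[ltRHS]lnK ?posrE // ltr_expR.
have e2 : cmod (f p) < expR t2 by rewrite -[ltLHS]lnK ?posrE // ltr_expR.
have d0 : 0 < Num.min (cmod (f p) - expR t1) (expR t2 - cmod (f p)).
  by rewrite lt_min !subr_gt0 e1.
have /cvgrPdist_lt/(_ _ d0)/nbhs_cmod[r1 r10 H1] := cf.
pose r := Num.min r0 r1.
have band u : cmod (u - p) < r -> level_band D f a b u.
  rewrite lt_min => /andP[/HD Du /H1]; rewrite lt_min !ltr_norml => /andP[/andP[k1 k2] /andP[k3 k4]].
  split=> //=; have fu : 0 < cmod (f u) by have := expR_gt0 t1; lra.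
  rewrite /lnmod lne_EFin //; apply/andP; split.
    by apply: lt_trans h3 _; rewrite lte_fin -ltr_expR lnK ?posrE //; lra.
  by apply: lt_trans h4; rewrite lte_fin -ltr_expR lnK ?posrE //; lra.
exists r; first by rewrite lt_min r00.
move=> u ur; pose seg := [set p + rc t * (u - p) | t in `[0, 1]%classic].
have cseg : connected seg.
  apply: connected_continuous_connected; first exact: segment_connected.
  apply: continuous_subspaceT => t; exact (@line_cvg R p (u - p) t).
have segE v : seg v -> level_band D f a b v.
  move=> [t]; rewrite /= in_itv /= => ht <-; apply: band; apply: ball_convex => //.
  by rewrite subrr cmod0; apply: le_lt_trans ur; exact: cmod_ge0.
have pseg : seg p by exists 0; [rewrite /= in_itv /= lexx ler01|rewrite rc0 mul0r addr0].
have useg : seg u.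
  by exists 1; [rewrite /= in_itv /= lexx ler01|rewrite rc1 mul1r subrKC].
have UE v : U v -> level_band D f a b v by rewrite EU; exact: connected_component_sub.
have cU : connected (U `|` seg).
  apply: connectedU => //; first by exists p.
  by rewrite EU; exact: component_connected.
have := @connected_component_max _ (level_band D f a b) (U `|` seg) z0.
rewrite -EU => H; apply: H => //.
- by left; rewrite EU; exact: connected_component_refl.
- by move=> v [/UE|/segE].
- by right.
Qed.

Lemma U_derivable z : U z -> derivable f z 1. Proof. by case/U_band. Qed.
Lemma U_derive_neq0 z : U z -> derive1 f z != 0. Proof. by case/U_band. Qed.

Lemma U_cluster t1 t2 (qn : nat -> C) : (a < t1%:E)%E -> (t2%:E < b)%E ->
  (forall n, U (qn n) /\ t1 <= ln (cmod (f (qn n))) <= t2) ->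
  exists2 q, U q & forall e, 0 < e -> forall m : nat, exists2 n, (m <= n)%N & cmod (qn n - q) < e.
Proof.
move=> at1 t2b qnP; have [[oD anf ab comp prop] reg] := hU.
have sub : `[t1, t2]%classic `<=` [set t : R | (a < t%:E < b)%E].
  move=> t /=; rewrite in_itv /= => /andP[h1 h2]; apply/andP; split.
    by apply: lt_le_trans at1 _; rewrite lee_fin.
  by apply: le_lt_trans t2b; rewrite lee_fin.
have cK := prop _ (@segment_compact _ t1 t2) sub.
have [n|q [Uq _] cq] := cluster_seq (u := qn) cK.
  have [Un hn] := qnP n; split=> //; exists (ln (cmod (f (qn n)))).
    by rewrite /= in_itv.
  by have [_ _ _ ? _] := U_band Un.
by exists q => // e e0 N; exact: cq (near_cmod q e0) N.
Qed.

Lemma exp_proper z : S z -> exists2 r, 0 < r & forall qn : nat -> C,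
  (forall n, U (qn n) /\ exists2 u, cmod (u - z) < r & f (qn n) = cexp u) ->
  exists2 q, U q & forall e, 0 < e -> forall m : nat, exists2 n, (m <= n)%N & cmod (qn n - q) < e.
Proof.
move=> /ereal_itv_inner[t1 [t2 [h1 h2 h3 h4]]].
exists (Num.min (Re z - t1) (t2 - Re z)); first by rewrite lt_min !subr_gt0 h1.
move=> qn qnP; apply: (@U_cluster t1 t2) => // n.
have [Un [u]] := qnP n; rewrite lt_min => /andP[u1 u2] fE; split=> //.
rewrite fE ln_cmod_cexp; have := Re_cmod (u - z); rewrite !ReImE ler_norml; lra.
Qed.

Local Notation lift := (lift_on U f (@cexp R)).

Lemma lift_through z0 q0 : S z0 -> U q0 -> f q0 = cexp z0 -> exists2 g, lift S g & g z0 = q0.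
Proof.
move=> Sz0 Uq0 fq0.
apply: (lift_exists U_open U_derivable U_derive_neq0 (@strip_open a b) (@strip_convex a b) _ exp_proper) => //.
by move=> z _; exact (@cexp_continuous R z).
Qed.

Lemma lift_shift g k : lift S g -> lift S (fun z => g (z + ic * rc (tau * k%:~R))).
Proof.
move=> lg z Sz; have [h1 h2 h3] := lg _ (strip_shift (tau * k%:~R) Sz).
split; [exact h1|by rewrite h2 cexp_shift|].
exact (at_comp (atD (@cvg_id _ _) (at_cst _)) h3).
Qed.

Lemma S_of_U z u : U z -> f z = cexp u -> S u.
Proof.
move=> /U_band[_ _ _ _]; rewrite /strip /= => h E; by move: h; rewrite E ln_cmod_cexp.
Qed.

Lemma S_unique N g1 g2 u v : is_convex N -> lift N g1 -> lift N g2 -> N u -> g1 u = g2 u -> N v -> g1 v = g2 v.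
Proof. exact: (lift_unique U_open U_derivable U_derive_neq0). Qed.

(** The lift g maps the strip onto U, as U is connected: near each p in U there
    is a lift h with values near p; if one value of h is a value of g, say
    h u = g v, then v - u is a period of exp, and h is a translate of g. *)
Lemma lift_surj g : lift S g -> (exists z, S z) -> forall p, U p -> exists2 z, S z & g z = p.
Proof.
move=> lg [zS SzS].
pose B := [set p | exists2 z, S z & g z = p].
have BU p : B p -> U p by move=> [z Sz <-]; have [] := lg _ Sz.
have key p : U p -> exists2 r, 0 < r &
    (forall q, cmod (q - p) < r -> U q) /\
    forall q q', cmod (q - p) < r -> cmod (q' - p) < r -> B q -> B q'.
  move=> Up; have [[_ fp] _ _ _ _] := U_band Up.
  have [z fz] := cexp_surj fp; have Sz := S_of_U Up (esym fz).
  have [h lh hz] := lift_through Sz Up (esym fz).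
  have [r r0 Hr] := lift_open U_open U_derivable U_derive_neq0 (@strip_open a b) lh Sz.
  exists r => //; rewrite hz in Hr; split=> [q /Hr[u Su <-]|q q' /Hr[u Su <-] /Hr[u' Su' <-]].
    by have [] := lh _ Su.
  move=> [v Sv gv].
  have : cexp v = cexp u by have [_ <- _] := lg _ Sv; have [_ <- _] := lh _ Su; rewrite gv.
  move=> /cexp_eq[k vE]; exists (u' + ic * rc (tau * k%:~R)); first exact: strip_shift.
  apply: (S_unique (@strip_convex a b) (lift_shift k lg) lh Su _ Su').
  by rewrite -vE.
have [[_ _ _ [z0 Ez0 EU] _] _] := hU.
have oB V : metric_open V -> open V.
  by move=> oV; rewrite openE => z /oV[r r0 Hr]; apply/nbhs_cmod; exists r.
have cU : connected U by rewrite EU; exact: component_connected.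
suff BE : B = U by move=> p; rewrite -BE.
apply: cU.
- by exists (g zS), zS.
- exists B; last by apply/seteqP; split=> [p Bp|p [_ Bp]] //; split=> //; exact: BU.
  apply: oB => p Bp; have [r r0 [rU rB]] := key _ (BU _ Bp); exists r => // u ur.
  by apply: (rB p u) => //; rewrite subrr cmod0.
- exists (~` (U `\` B)).
    apply: open_closedC; apply: oB => p [Up nBp]; have [r r0 [rU rB]] := key _ Up.
    exists r => // u ur; split; first exact: rU.
    by move=> Bu; apply: nBp; apply: (rB u p) => //; rewrite subrr cmod0.
  apply/seteqP; split=> [p Bp|p [Up nUB]]; first by split; [exact: BU|case].
  by apply: contrapT => nB; apply: nUB.
Qed.

(** If g z = g u then z - u = 2 i pi k for an integer k, and k is then a period
    of g everywhere. Nonzero periods exist: the points g (z + 2 i pi n), n in nat,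
    stay on a compact level set and f is locally injective near a cluster point,
    so two of them coincide. Hence T is 2 pi times the least positive period. *)
Lemma lift_period g : lift S g -> (exists z, S z) ->
  exists2 T, 0 < T & (forall z, S z -> g (z + ic * rc T) = g z) /\
    forall z u, S z -> S u -> g z = g u -> exists m : int, z = u + ic * rc (T * m%:~R).
Proof.
move=> lg [zS SzS].
pose per (k : int) := forall z, S z -> g (z + ic * rc (tau * k%:~R)) = g z.
have perP z (k : int) : S z -> g (z + ic * rc (tau * k%:~R)) = g z -> per k.
  move=> Sz gz u Su.
  exact: (S_unique (@strip_convex a b) (lift_shift k lg) lg Sz gz Su).
have [t1 [t2 [h1 h2 h3 h4]]] := ereal_itv_inner SzS.
have shiftS k z : S z -> S (z + ic * rc (tau * k%:~R)) by exact: strip_shift.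
have addk z (k m : int) : z + ic * rc (tau * k%:~R) + ic * rc (tau * m%:~R) = z + ic * rc (tau * (k + m)%:~R).
  by rewrite intrD mulrDr rcD; ring.
have [n [m [nm perk]]] : exists n m : nat, (n < m)%N /\ per (m%:Z - n%:Z).
  pose qn (n : nat) := g (zS + ic * rc (tau * (n%:Z)%:~R)).
  have [n|q Uq cq] := @U_cluster t1 t2 qn h3 h4.
    have [Ug fg _] := lg _ (shiftS n%:Z _ SzS); split=> //.
    by rewrite fg cexp_shift ln_cmod_cexp !ltW.
  have [k [eta [delta [[k0 eta0 _] _ low _]]]] :=
    local_inverse U_open U_derivable Uq (U_derive_neq0 Uq).
  have [n _ qn1] := cq eta eta0 0%N; have [m nm qm1] := cq eta eta0 n.+1.
  exists n, m; split=> //.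
  apply: (perP (zS + ic * rc (tau * (n%:Z)%:~R))); first exact: shiftS.
  rewrite addk subrKC.
  have := low _ _ qm1 qn1; rewrite /qn.
  have [_ -> _] := lg _ (shiftS m%:Z _ SzS); have [_ -> _] := lg _ (shiftS n%:Z _ SzS).
  rewrite !cexp_shift subrr cmod0 pmulr_rle0 // => h.
  by apply/eqP; rewrite -subr_eq0 -cmod_eq0 eq_le h cmod_ge0.
have exN : exists n : nat, [&& (0 < n)%N & `[< per n%:Z >] ].
  exists (m - n)%N; rewrite subn_gt0 nm /=; apply/asboolP.
  by rewrite -subzn // ltnW.
have := ex_minnP exN; case=> N /andP[N0 /asboolP perN] minN.
have perNN (k : int) (q : nat) : per k -> per (k * q%:Z).
  move=> pk; elim: q => [|q IH] z Sz; first by rewrite mulr0 mulr0 rc0 mulr0 addr0.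
  have -> : k * q.+1%:Z = k * q%:Z + k by rewrite -addn1 PoszD mulrDr mulr1.
  by rewrite -addk pk ?IH //; exact: shiftS.
have perO (k : int) : per k -> per (- k).
  move=> pk z Sz; rewrite -[RHS](_ : g (z + ic * rc (tau * (- k)%:~R) + ic * rc (tau * k%:~R)) = _).
    by rewrite pk //; exact: shiftS.
  by rewrite addk addNr mulr0 rc0 mulr0 addr0.
have perD (k l : int) : per k -> per l -> per (k + l).
  by move=> pk pl z Sz; rewrite -addk pl ?pk //; exact: shiftS.
exists (tau * N%:R); first by rewrite mulr_gt0 ?ltr0n // tau_gt0.
split; first by move=> z Sz; have := perN z Sz.
move=> z u Sz Su gzu.
have [k zE] : exists k : int, z = u + ic * rc (tau * k%:~R).
  by apply: cexp_eq; have [_ <- _] := lg _ Sz; have [_ <- _] := lg _ Su; rewrite gzu.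
have pk : per k by apply: (perP u) => //; rewrite -zE.
have kE := divz_eq k N%:Z.
have pr : per (k %% N%:Z)%Z.
  have -> : (k %% N%:Z)%Z = k - (k %/ N%:Z)%Z * N%:Z by rewrite {2}kE; ring.
  apply: (perD) => //; apply: (perO); case: (k %/ N%:Z)%Z => q; first by rewrite mulrC; exact: perNN.
  by rewrite NegzE mulNr; apply: perO; rewrite mulrC; exact: perNN.
have r0 : (k %% N%:Z)%Z = 0.
  have Nn0 : N%:Z != 0 :> int by case: N N0 {minN perN kE pr}.
  have := modz_ge0 k Nn0; have := ltz_mod k Nn0.
  case: (k %% N%:Z)%Z pr => // -[//|r] pr rN _.
  have : (N <= r.+1)%N by apply: minN; rewrite ltn0Sn; exact/asboolP.
  by rewrite leqNgt; move: rN; rewrite ger0_norm // ltz_nat => ->.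
exists (k %/ N%:Z)%Z; rewrite zE {1}kE r0 addr0; congr (_ + ic * rc _).
by rewrite intrM -[(N%:Z)%:~R]/(N%:R) -mulrA [N%:R * _]mulrC.
Qed.

(** Differentiate f (g z) = exp z. *)
Lemma lift_cder g z : lift S g -> S z -> cder g z (cexp z / derive1 f (g z)).
Proof.
move=> lg Sz; have [Ug fg cg] := lg _ Sz.
apply: (cder_implicit (F := f) (E := @cexp R) cg).
- have [r r0 Hr] := strip_open Sz.
  by apply/nbhs_cmod; exists r => // u /Hr Su; have [] := lg _ Su.
- exact/derivable_cder/U_derivable.
- exact: U_derive_neq0.
- exact: cder_cexp.
Qed.

(** Squaring is a proper local homeomorphism of the punctured plane, and g' does
    not vanish: lift g' through it. *)
Lemma lift_sqrt g : lift S g -> (exists z, S z) ->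
  exists2 h : C -> C, (forall z, S z -> derivable h z 1) & forall z, S z -> h z ^+ 2 = derive1 g z.
Proof.
move=> lg [zS SzS].
pose U2 := [set q : C | q != 0]; pose F2 (q : C) : C := q * q.
have oU2 : metric_open U2.
  move=> z z0; exists (cmod z); first by rewrite cmod_gt0.
  by move=> u; rewrite /U2 /=; apply: contraTneq => ->; rewrite sub0r cmodN ltxx.
have dF2 z : cder F2 z (1 * z + z * 1) := cderM (cder_id z) (cder_id z).
have dF2' z : derive1 F2 z = z + z by have [_ ->] := cder_derivable (dF2 z); ring.
have F20 z : U2 z -> derive1 F2 z != 0.
  by move=> z0; rewrite dF2' -mulr2n mulrn_eq0.
have dg z : S z -> derivable g z 1 by move=> Sz; exact: (cder_derivable (lift_cder lg Sz)).1.
have cg' z : S z -> derive1 g @ z --> derive1 g z.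
  by move=> Sz; exact (derive1_continuous (@strip_open a b) dg Sz).
have dg' z : S z -> derivable (derive1 g) z 1.
  by move=> Sz; exact (derive1_derivable (@strip_open a b) dg Sz).
have g'0 z : S z -> derive1 g z != 0.
  move=> Sz; have [_ ->] := cder_derivable (lift_cder lg Sz).
  by have [Ug _ _] := lg _ Sz; rewrite mulf_neq0 ?cexp_neq0 // invr_eq0 U_derive_neq0.
move: (derive1 g) cg' dg' g'0 => G cg' dg' g'0.
have prop z : S z -> exists2 r, 0 < r & forall qn : nat -> C,
  (forall n, U2 (qn n) /\ exists2 u, cmod (u - z) < r & F2 (qn n) = G u) ->
  exists2 q, U2 q & forall e, 0 < e -> forall m : nat, exists2 n, (m <= n)%N & cmod (qn n - q) < e.
  move=> Sz; pose l := cmod (G z); have l0 : 0 < l by rewrite cmod_gt0 g'0.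
  have l2 : 0 < l / 2 by rewrite divr_gt0.
  have /cvg_cmod/(_ _ l2)/nbhs_cmod[r r0 Hr] := cg' z Sz.
  exists r => // qn qnP.
  have bnd n : l / 2 <= cmod (qn n) ^+ 2 <= 2 * l.
    have [_ [u /Hr ur E]] := qnP n; rewrite expr2 -cmodM -/(F2 _) E.
    have k1 := cmod_rev (G z) (G u); rewrite cmodC in k1.
    have k2 := cmod_rev (G u) (G z).
    by move: ur k1 k2; rewrite -/l; lra.
  have [|q cq] := @bounded_cluster R qn (2 * l + 1).
    by move=> n; have /andP[_] := bnd n; have := cmod_ge0 (qn n); nra.
  exists q => //; rewrite /U2 /=; apply/eqP => q0.
  have e0 : 0 < Num.min 1 (l / 2) by rewrite lt_min ltr01.
  have [n _] := cq _ e0 0%N; rewrite q0 subr0 lt_min => /andP[c1 c2].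
  have /andP[b1 _] := bnd n; have := cmod_ge0 (qn n); nra.
pose q0 : C := sqrtc (G zS : R[i]).
have q02 : F2 q0 = G zS by rewrite /F2 -expr2 /q0 sqr_sqrtc.
have Uq0 : U2 q0.
  rewrite /U2 /=; apply: contraTneq (g'0 _ SzS) => e; by rewrite -q02 e /F2 mulr0 eqxx.
have [h lh _] := lift_exists oU2 (fun z _ => (cder_derivable (@dF2 z)).1) F20
   (@strip_open a b) (@strip_convex a b) cg' prop SzS Uq0 q02.
exists h => z Sz; last by have [_ E _] := lh _ Sz; rewrite expr2.
have [Uh Fh ch] := lh _ Sz.
suff [l dl] : exists l, cder h z l by exact: (cder_derivable dl).1.
eexists; apply: (cder_implicit (F := F2) (E := G) ch _ (dF2 _) _ (derivable_cder (dg' _ Sz))).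
  have [r r0 Hr] := strip_open Sz.
  by apply/nbhs_cmod; exists r => // u /Hr Su; have [] := lh _ Su.
by have := F20 _ Uh; rewrite dF2' mul1r mulr1.
Qed.

End Uniformization.

(** * Arc length on a level curve *)
Section Arclength.
Variable R : realType.
Local Notation C := (Cplx R).
Local Notation Re := (@complex.Re R).
Local Notation Im := (@complex.Im R).
Local Notation rc := (@rc R).
Local Notation ic := (@ic R).
Local Notation mu := (@lebesgue_measure R).
Local Notation pt x y := (rc x + ic * rc y).
Implicit Types (x y e r s t d : R) (z u v p q l : C) (k m : int).

Lemma rder_derive1 (c : R -> C) s l : rder c s l ->
  [/\ derivable (fun x => Re (c x)) s 1, derivable (fun x => Im (c x)) s 1,
   derive1 (fun x => Re (c x)) s = Re l & derive1 (fun x => Im (c x)) s = Im l].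
Proof.
move=> /rderP[[d1 e1] [d2 e2]].
by split; [exact d1|exact d2|rewrite derive1E; exact e1|rewrite derive1E; exact e2].
Qed.

Lemma speedE (c : R -> C) s l : rder c s l -> speed c s = cmod l.
Proof. by move=> /rder_derive1[_ _ e1 e2]; rewrite /speed e1 e2 cmodE. Qed.

Lemma derivable_rder (c : R -> C) s : derivable (fun x => Re (c x)) s 1 ->
  derivable (fun x => Im (c x)) s 1 ->
  rder c s (Complex (derive1 (fun x => Re (c x)) s) (derive1 (fun x => Im (c x)) s)).
Proof.
move=> d1 d2; apply/rderP; rewrite !derive1E; split.
  exact (DeriveDef d1 erefl).
exact (DeriveDef d2 erefl).
Qed.

Lemma is_derive_cvg (F : R -> R) s (l : R) : is_derive s (1 : R) F l -> F @ s --> F s.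
Proof. by case=> d _; apply: differentiable_continuous; apply/derivable1_diffP. Qed.

Lemma ivt01 (F : R -> R) (v : R) : (forall s, F @ s --> F s) -> F 0 <= v <= F 1 ->
  exists2 s, 0 <= s <= 1 & F s = v.
Proof.
move=> cF hv; have [||s] := @IVT R F 0 1 v ler01.
- by apply: continuous_subspaceT => s; exact: cF.
- have /andP[v0 v1] := hv; have F01 := le_trans v0 v1.
  by rewrite (min_idPl F01) (max_idPr F01).
by rewrite in_itv /=; exists s.
Qed.

Lemma int_gt0_ge1 (m : int) : 0 < m%:~R :> R -> 1 <= m%:~R :> R.
Proof. by rewrite ltr0z => m0; rewrite -[1]/(1%:~R) ler_int. Qed.

(* In what follows g is the uniformizing map of U, T its period and t a level;
   y |-> g (t + i y) runs once through the level curve as y runs over [0, T[. *)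
Variables (D U : set C) (f : C -> C) (a b : \bar R).
Hypothesis hU : regular_lemniscate_region D U f a b.
Local Notation S := (strip a b).
Variable g : C -> C.
Hypothesis lg : lift_on U f (@cexp R) S g.
Variable T : R.
Hypothesis T0 : 0 < T.
Hypothesis gT : forall z, S z -> g (z + ic * rc T) = g z.
Hypothesis ginj : forall z u, S z -> S u -> g z = g u ->
  exists m : int, z = u + ic * rc (T * m%:~R).
Variable t : R.
Hypothesis tab : (a < t%:E < b)%E.

Let Udf : forall z, U z -> derivable f z 1. Proof. exact: (U_derivable hU). Qed.
Let Uf' : forall z, U z -> derive1 f z != 0. Proof. exact: (U_derive_neq0 hU). Qed.
Let Uo : metric_open U. Proof. exact: (U_open hU). Qed.

Definition level_curve y := g (pt t y).
Definition level_velocity y := (cexp (pt t y) / derive1 f (level_curve y)) * ic.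

Lemma Re_pt x y : Re (pt x y) = x. Proof. by rewrite !ReImE; ring. Qed.
Lemma Im_pt x y : Im (pt x y) = y. Proof. by rewrite !ReImE; ring. Qed.

Lemma S_pt y : S (pt t y). Proof. by have := Re_pt t y; rewrite /strip /mkset => ->. Qed.

Lemma level_curve_U y : U (level_curve y). Proof. by have [] := lg (S_pt y). Qed.
Lemma f_level_curve y : f (level_curve y) = cexp (pt t y). Proof. by have [] := lg (S_pt y). Qed.

Lemma level_curve_rder y : rder level_curve y (level_velocity y).
Proof.
exact (rder_comp (F := g) (f := fun y => pt t y) (lift_cder hU lg (S_pt y)) (rder_pt_y t y)).
Qed.

Lemma level_curve_continuous : continuous level_curve.
Proof. by move=> y; exact (rder_cvg (level_curve_rder y)). Qed.

Lemma level_velocity_continuous : continuous level_velocity.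
Proof.
move=> y; apply: (fun H => atM H (at_cst ic)).
have c1 : (fun y => pt t y) @ y --> pt t y := rder_cvg (rder_pt_y t y).
have c2 : (fun y => derive1 f (level_curve y)) @ y --> derive1 f (level_curve y).
  exact (at_comp (@level_curve_continuous y) (derive1_continuous Uo Udf (level_curve_U y))).
exact (atM (at_comp c1 (@cexp_continuous R _)) (atV (Uf' (level_curve_U y)) c2)).
Qed.

Lemma cmod_level_velocity y : cmod (level_velocity y) = cmod (f (level_curve y)) / cmod (derive1 f (level_curve y)).
Proof. by rewrite /level_velocity !cmodM cmodV cmod_ic mulr1 f_level_curve. Qed.

Lemma level_velocity_neq0 y : level_velocity y != 0.
Proof. by rewrite !mulf_neq0 ?cexp_neq0 ?ic_neq0 // invr_eq0; apply: Uf'; exact: level_curve_U. Qed.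

Lemma level_curve_period y : level_curve (y + T) = level_curve y.
Proof.
rewrite /level_curve -(gT (S_pt y)); congr g.
by rewrite rcD mulrDr addrA.
Qed.

Lemma level_curve_shift y (m : int) : level_curve (y + T * m%:~R) = level_curve y.
Proof.
have pern y' (n : nat) : level_curve (y' + T * n%:R) = level_curve y'.
  elim: n => [|n IH]; first by rewrite mulr0 addr0.
  by rewrite -natr1 mulrDr mulr1 addrA level_curve_period.
case: m => n; first exact: pern.
by rewrite NegzE mulrNz mulrN -(pern (y - T * n.+1%:R) n.+1) subrK.
Qed.

Lemma level_curve_inj y y' : level_curve y = level_curve y' -> exists m : int, y = y' + T * m%:~R.
Proof.
move=> /(ginj (S_pt y) (S_pt y'))[m E]; exists m.
by rewrite -(Im_pt t y) E !ReImE; ring.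
Qed.

Local Notation Et := (level_set D f t `&` U).

Hypothesis gsurj : forall p, U p -> exists2 z, S z & g z = p.

Lemma level_curveP p : Et p <-> exists y, level_curve y = p.
Proof.
split=> [[[_ lp] Up]|[y <-]].
  have [u Su gu] := gsurj Up; exists (Im u); rewrite /level_curve -gu; congr g.
  have [_ fu _] := lg Su.
  have [_ _ _ lE _] := U_band hU Up.
  move: lp; rewrite /= lE -gu fu ln_cmod_cexp => -[<-].
  by rewrite [RHS]ReIm.
have Uy := level_curve_U y; have [[Dy _] _ _ lE _] := U_band hU Uy; split=> //; split=> //=.
by rewrite lE f_level_curve ln_cmod_cexp Re_pt.
Qed.

(** The level set is a single closed curve, described by y = T s. *)
Lemma level_curve_exists : parametrizes (fun _ : 'I_1 => fun s => level_curve (T * s)) Et.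
Proof.
have dc s : rder (fun s => level_curve (T * s)) s (level_velocity (T * s) * rc T).
  have d1 : rder (fun s => rc (T * s)) s (rc T).
    have := rder_line 0 (rc T) s; apply: der_ext => y.
    by rewrite add0r rcM mulrC.
  have d2 : rder (fun s => rc t + ic * rc (T * s)) s (0 + (0 * rc (T * s) + ic * rc T)).
    exact (derD (der_cst rc (rc t) s) (rderM (der_cst rc ic s) d1)).
  have := rder_comp (F := g) (f := fun s => pt t (T * s)) (lift_cder hU lg (S_pt (T * s))) d2.
  by move=> /der_eq; apply; rewrite mul0r !add0r mulrA.
have cTs (s : R) : (fun s => T * s) @ s --> T * s.
  exact: mulrl_continuous.
have cd : continuous (fun s => level_velocity (T * s) * rc T).
  by move=> s; exact (atM (at_comp (cTs s) (@level_velocity_continuous _)) (at_cst _)).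
split.
- move=> _; split.
  + by move=> s; have [d1 _ _ _] := rder_derive1 (dc s); exact d1.
  + by move=> s; have [_ d1 _ _] := rder_derive1 (dc s); exact d1.
  + rewrite (_ : derive1 _ = fun s => Re (level_velocity (T * s) * rc T)).
      by move=> s; exact (at_Re (@cd s)).
    by apply/funext => s; have [_ _ e1 _] := rder_derive1 (dc s); exact e1.
  + rewrite (_ : derive1 _ = fun s => Im (level_velocity (T * s) * rc T)).
      by move=> s; exact (at_Im (@cd s)).
    by apply/funext => s; have [_ _ _ e1] := rder_derive1 (dc s); exact e1.
  + by move=> s; rewrite mulrDr mulr1 level_curve_period.
  + by move=> s; rewrite (speedE (dc s)) cmod_eq0 mulf_neq0 ?level_velocity_neq0 // rc_eq0 gt_eqF.
- apply/seteqP; split=> p.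
    move=> /level_curveP[y <-]; exists ord0 => //; exists (y / T) => //.
    by rewrite mulrC divfK // gt_eqF.
  by move=> [_ _ [s _ <-]]; apply/level_curveP; exists (T * s).
move=> i j s u /andP[s0 s1] /andP[u0 u1] E; split; first by rewrite (ord1 i) (ord1 j).
have [m Em] := level_curve_inj E.
have {}Em : s = u + m%:~R.
  by apply: (mulfI (x := T)); rewrite ?gt_eqF // mulrDr.
have [m0|m0|m0] := ltgtP (m%:~R : R) 0; last by rewrite Em m0 addr0.
  have := @int_gt0_ge1 (- m); rewrite mulrNz; lra.
by have := int_gt0_ge1 m0; lra.
Qed.

(** Let om = (f o c)' / (f o c), with primitive Th such that g (Th 0) = c 0. Then
    f (c s) = exp (Th s), and as |f (c s)| = e^t, Th s = t + i th s. Both c and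
    g o Th lift f o c through f, so they agree. *)
Lemma curve_lift (c : R -> C) : regular_closed_curve c -> (forall s, Et (c s)) ->
  exists th dth : R -> R, [/\ forall s, is_derive s (1 : R) th (dth s), continuous dth,
    forall s, dth s != 0,
    forall s, 0 <= s <= 1 -> c s = level_curve (th s) &
    forall s, 0 <= s <= 1 -> speed c s = `|dth s| * cmod (level_velocity (th s))].
Proof.
move=> [dRe dIm cRe cIm _ sp0] cE.
have cU s : U (c s) by have [] := cE s.
pose l s : C := Complex (derive1 (fun x => Re (c x)) s) (derive1 (fun x => Im (c x)) s).
have dc s : rder c s (l s) by exact: derivable_rder.
have cl : continuous l by move=> s; apply: at_ReIm; [exact: cRe|exact: cIm].
have cc s : c @ s --> c s := rder_cvg (dc s).
have fc0 s : f (c s) != 0 by have [[]] := U_band hU (cU s).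
have l0 s : l s != 0 by have := sp0 s; rewrite (speedE (dc s)) cmod_eq0.
have dfc s : rder (fun s => f (c s)) s (derive1 f (c s) * l s).
  exact (rder_comp (derivable_cder (Udf (cU s))) (dc s)).
pose om s := derive1 f (c s) * l s / f (c s).
have com : continuous om.
  move=> s; have c1 := at_comp (cc s) (derive1_continuous Uo Udf (cU s)).
  exact (atM (atM c1 (@cl s)) (atV (fc0 s) (rder_cvg (dfc s)))).
have [u0 Su0 gu0] := gsurj (cU 0).
have [_ fu0 _] := lg Su0.
pose Th s := cprim om s - cprim om 0 + u0.
have dTh s : rder Th s (om s).
  have := derD (derB (cprimP com s) (der_cst rc (cprim om 0) s)) (der_cst rc u0 s).
  by rewrite subr0 addr0.
have Th0 : Th 0 = u0 by rewrite /Th subrr add0r.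
have fTh s : f (c s) = cexp (Th s).
  pose Q s := f (c s) * cexp (- Th s).
  have dQ s' : rder Q s' 0.
    have d1 := rder_comp (F := @cexp R) (f := fun s => - Th s) (cder_cexp (- Th s')) (derN (dTh s')).
    apply: (der_eq (rderM (dfc s') d1)).
    by rewrite /om; field.
  have Q0 : Q 0 = 1 by rewrite /Q Th0 -gu0 fu0 -cexpD subrr cexp0.
  have Qs : Q s = 1.
    rewrite -Q0; have [s0|/ltW s0] := leP 0 s.
      by apply: rder0_cst s0 => x _; exact: dQ.
    by apply/esym; apply: rder0_cst s0 => x _; exact: dQ.
  have := congr1 (fun z => z * cexp (Th s)) Qs.
  by rewrite /Q -mulrA -cexpD addNr cexp0 mulr1 mul1r.
have ReTh s : Re (Th s) = t.
  have [[_ /= le] _] := cE s; have [_ _ _ lE _] := U_band hU (cU s).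
  by move: le; rewrite lE fTh ln_cmod_cexp => -[].
pose th s := Im (Th s); pose dth s := Im (om s).
have Reom s : Re (om s) = 0.
  have /rderP[[_ d1] _] := dTh s.
  rewrite -d1 (_ : (fun _ => _) = fun=> t); first by rewrite derive_cst.
  by apply/funext => x; exact: ReTh.
have omE s : om s = ic * rc (dth s) by rewrite {1}(ReIm (om s)) Reom rc0 add0r.
have ThE s : Th s = pt t (th s) by rewrite {1}(ReIm (Th s)) ReTh.
have cgam s : 0 <= s <= 1 -> c s = level_curve (th s).
  move=> /andP[s0 _]; rewrite /level_curve -ThE.
  apply: (path_unique Uo Udf Uf' (c1 := c) (c2 := fun s => g (Th s)) s0); last by rewrite Th0.
  move=> r _; have Sr : S (Th r) := S_of_U hU (cU r) (fTh r).
  have [_ h2 h3] := lg Sr.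
  split; [exact: cU|by rewrite h2|exact (cc r)|exact (at_comp (rder_cvg (dTh r)) h3)].
exists th, dth; split.
- by move=> s; have /rderP[] := dTh s.
- by move=> s; exact (at_Im (@com s)).
- move=> s; have : om s != 0 by rewrite !mulf_neq0 ?invr_eq0 ?Uf'.
  by rewrite omE; apply: contraNneq => ->; rewrite rc0 mulr0.
- exact: cgam.
move=> s hs; rewrite (speedE (dc s)) cmod_level_velocity -cgam //.
have -> : `|dth s| = cmod (om s) by rewrite omE cmodM cmod_ic mul1r cmod_rc.
rewrite /om !cmodM cmodV; field.
by rewrite !cmod_eq0 fc0 Uf'.
Qed.

Variable h : C -> R.
Hypothesis h_cont : forall z, U z -> h @ z --> h z.

Definition arclength_density y := h (level_curve y) * cmod (level_velocity y).

Lemma arclength_density_continuous : continuous arclength_density.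
Proof.
move=> y; apply: (@cvgM R R (nbhs y)).
  exact (cvg_comp _ _ (@level_curve_continuous y) (h_cont (level_curve_U y))).
exact (at_cmod (@level_velocity_continuous y)).
Qed.

Lemma arclength_density_shift y : arclength_density (y + T) = arclength_density y.
Proof.
have gy := level_curve_period y.
have dy : cmod (level_velocity (y + T)) = cmod (level_velocity y) := etrans (cmod_level_velocity (y + T))
  (etrans (congr1 (fun z => cmod (f z) / cmod (derive1 f z)) gy) (esym (cmod_level_velocity y))).
exact (congr2 (fun p r => h p * r) gy dy).
Qed.

Variable K : R -> R.
Hypothesis dK : forall y, is_derive y (1 : R) K (arclength_density y).

Lemma primitive_shift y : K (y + T) - K y = K T - K 0.
Proof.
have d x : is_derive x (1 : R) (fun x => K (x + T) - K x) 0.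
  rewrite -(subrr (arclength_density x)); apply: is_deriveB.
  rewrite -{1}(arclength_density_shift x) -[arclength_density (x + T)]mulr1.
  have d1 : is_derive x (1 : R) (fun x : R => x + T) 1.
    have := is_deriveD (is_derive_id x (1 : R)) (is_derive_cst T x (1 : R)).
    by rewrite addr0.
  exact: (@is_derive1_comp _ K (fun x => x + T) x _ _ (dK (x + T)) d1).
have := @is_derive_0_is_cst R (fun x => K (x + T) - K x) y 0 d.
by rewrite add0r.
Qed.

(** By curve_lift c s = g (t + i th s) with th' of constant sign sg. As c is
    closed, th varies by a multiple of T, and it varies by T exactly, else c
    would take the value c 0 in between. So c runs once through the level set and
    the substitution y = th s turns its integral into that of the density over
    one period. *)
Lemma curve_value (c : R -> C) : regular_closed_curve c -> (forall s, Et (c s)) ->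
  (forall s r, 0 <= s < 1 -> 0 <= r < 1 -> c s = c r -> s = r) ->
  (forall p, Et p -> exists2 s, 0 <= s < 1 & c s = p) /\
  (\int[mu]_(s in `[0%R, 1%R]) (h (c s) * speed c s))%R = K T - K 0.
Proof.
move=> rc_c cE cinj; have [th [dth [dthP cdth dth0 cgam spE]]] := curve_lift rc_c cE.
have [sg sgP sgpos] : exists2 sg : R, sg = 1 \/ sg = -1 & forall s, 0 <= s <= 1 -> 0 < sg * dth s.
  pose sg := Num.sg (dth 0).
  have sgE : sg = 1 \/ sg = -1.
    by move: (dth0 0); rewrite neq_lt => /orP[?|?]; [right; exact: ltr0_sg|left; exact: gtr0_sg].
  exists sg => // s /andP[s0 s1].
  apply: (@segment_locally_constant R (fun s => 0 < sg * dth s) 0 s s0).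
    by rewrite /sg -normrEsg normr_gt0.
  move=> r hr; have /cvgrPdist_lt/(_ `|dth r|) := cdth r.
  rewrite normr_gt0 dth0 => /(_ isT)/nbhs_real[d d0 Hd]; exists d => //.
  have sgn (v : R) : `|dth r - v| < `|dth r| -> (0 < sg * v) = (0 < sg * dth r).
    have n1 : `|sg| = 1 by case: sgE => ->; rewrite ?normrN normr1.
    rewrite -[ltLHS]mul1r -[ltRHS]mul1r -n1 -!normrM mulrBr.
    move: (sg * dth r) (sg * v) => x y; case: (ltrgt0P x) => [x0|x0|->].
    - by rewrite ltr_norml => /andP[h1 h2]; apply/idP; lra.
    - by rewrite ltr_norml => /andP[h1 h2]; apply/negbTE; rewrite -leNgt; lra.
    - by rewrite ltNge normr_ge0.
  by move=> s' s'' _ _ /Hd/sgn h1 /Hd/sgn h2; rewrite h1 h2.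
have sg2 : sg * sg = 1 by case: sgP => ->; ring.
pose F s := sg * th s.
have cF s : F @ s --> F s.
  by apply: cvgM; [exact: cvg_cst|exact: is_derive_cvg (dthP s)].
have Fmono s (r : R) : 0 <= s -> s < r -> r <= 1 -> F s < F r.
  move=> s0 su u1.
  have [x hx E] := real_mvt (ltW su) (fun x _ => dthP x).
  rewrite /F -subr_gt0 -mulrBr E mulrA mulr_gt0 ?subr_gt0 // sgpos //; lra.
have sgth s : th s = sg * F s by rewrite /F mulrA sg2 mul1r.
have shift y (m : int) : level_curve (sg * (y + T * m%:~R)) = level_curve (sg * y).
  case: sgP => ->; first by rewrite !mul1r level_curve_shift.
  have -> : -1 * (y + T * m%:~R) = -1 * y + T * (- m)%:~R by rewrite mulrNz; ring.
  by rewrite level_curve_shift.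
have inj y y' : level_curve (sg * y) = level_curve (sg * y') -> exists m : int, y = y' + T * m%:~R.
  move=> /level_curve_inj[m]; case: sgP => ->; first by rewrite !mul1r; exists m.
  by rewrite !mulN1r => E; exists (- m); rewrite mulrNz; lra.
have c01 : c 1 = c 0 by rewrite -[1]add0r; exact: (rcc_periodic rc_c).
have F01 := Fmono 0 1 (lexx _) ltr01 (lexx _).
have FT : F 1 = F 0 + T.
  have [m Em] : exists m : int, F 1 = F 0 + T * m%:~R.
    by apply: inj; rewrite -!sgth -!cgam ?lexx ?ler01.
  have m0 : 0 < m%:~R :> R.
    by move: F01; rewrite Em ltrDl pmulr_rgt0.
  have m1 := int_gt0_ge1 m0.
  have FT1 : F 0 + T <= F 1 by rewrite Em lerD2l ler_peMr // ltW.
  apply/eqP; rewrite eq_le FT1 andbT leNgt; apply/negP => lt.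
  have [|s hs Fs] := @ivt01 F (F 0 + T) cF; first by rewrite FT1 lerDl ltW.
  have s1 : s < 1.
    case/andP: hs => _; rewrite le_eqVlt => /predU1P[E|//].
    by exfalso; rewrite E in Fs; lra.
  have s0 : s = 0.
    case/andP: hs => s0 _; apply: cinj; rewrite ?s0 ?lexx ?ltr01 //.
    rewrite !cgam ?lexx ?ler01 ?s0 ?(ltW s1) // !sgth Fs.
    by have := shift (F 0) 1; rewrite mulr1.
  by rewrite s0 in Fs; move: T0; lra.
split.
  move=> p /level_curveP[y <-].
  (* Shift sg * y by a multiple of T into [F 0, F 0 + T[. *)
  pose y1 := sg * y; pose m := Num.floor ((y1 - F 0) / T).
  have /andP[m1 m2] := floor_itv ((y1 - F 0) / T); rewrite -/m in m1 m2.
  pose y2 := y1 + T * (- m)%:~R.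
  have y20 : F 0 <= y2.
    by move: m1; rewrite ler_pdivlMr // /y2 mulrNz mulrC; lra.
  have y21 : y2 < F 1.
    by move: m2; rewrite ltr_pdivrMr // intrD mulrDl mul1r /y2 mulrNz FT mulrC; lra.
  have [|s hs Fs] := @ivt01 F y2 cF; first by rewrite y20 ltW.
  have s1 : s < 1.
    case/andP: hs => _; rewrite le_eqVlt => /predU1P[E|//].
    by exfalso; rewrite E in Fs; lra.
  exists s; first by case/andP: hs => ->.
  by rewrite cgam // sgth Fs /y2 shift /y1 mulrA sg2 mul1r.
pose kk s := sg * (arclength_density (th s) * dth s).
have ckk : continuous kk.
  move=> s; apply: cvgM; first exact: cvg_cst.
  apply: cvgM; last exact: cdth.
  exact (cvg_comp _ _ (is_derive_cvg (dthP s)) (@arclength_density_continuous (th s))).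
have dkk s : is_derive s (1 : R) (fun s => sg * K (th s)) (kk s).
  exact (is_deriveZ sg (@is_derive1_comp _ K th s _ _ (dK (th s)) (dthP s))).
transitivity (\int[mu]_(s in `[0%R, 1%R]) kk s)%R.
  apply: eq_Rintegral => s; rewrite inE /= in_itv /= => hs.
  rewrite (spE s hs) (cgam s hs) /kk /arclength_density.
  have -> : `|dth s| = sg * dth s.
    rewrite -(gtr0_norm (sgpos s hs)) normrM.
    by case: sgP => ->; rewrite ?normrN normr1 mul1r.
  ring.
rewrite (Rintegral_prim ckk dkk) !sgth.
rewrite FT; move: (F 0) => x0; case: sgP => ->; first by rewrite !mul1r; exact: primitive_shift.
rewrite !mulN1r -(primitive_shift (- (x0 + T))).
have -> : - (x0 + T) + T = - x0 by ring.
ring.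
Qed.

(** Any curve of a parametrization already covers the level set, so there is
    only one. *)
Lemma level_arclength : is_arclength_integral Et h (K T - K 0).
Proof.
split; first by exists 1%N, (fun _ : 'I_1 => fun s => level_curve (T * s)); exact: level_curve_exists.
move=> n c [cc cim cinj].
have cE i s : Et (c i s) by rewrite cim; exists i => //; exists s.
have val i := curve_value (cc i) (cE i) (fun s (u : R) hs hu E0 => (cinj i i s u hs hu E0).2).
have [i0] : exists i0 : 'I_n, True.
  have : Et (level_curve 0) by apply/level_curveP; exists 0.
  by rewrite cim => -[i _ _]; exists i.
move=> _; have all_i0 i : i = i0.
  have z01 : ((0 : R) <= 0) && ((0 : R) < 1) by apply/andP; split; [exact: lexx|exact: ltr01].
  have [s hs E] := (val i0).1 _ (cE i 0).
  by have [-> _] := cinj _ _ _ _ hs z01 E.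
rewrite (bigD1 i0) //= big1 ?addr0; first by rewrite (val i0).2.
by move=> i; rewrite (all_i0 i) eqxx.
Qed.

End Arclength.

(** * The analytic continuation *)
Section Continuation.
Variable R : realType.
Local Notation C := (Cplx R).
Local Notation Re := (@complex.Re R).
Local Notation Im := (@complex.Im R).
Local Notation rc := (@rc R).
Local Notation ic := (@ic R).
Local Notation pt x y := (rc x + ic * rc y).
Implicit Types (x y s t : R) (z u v p q l : C).

Lemma cder_conj (F : C -> C) z l : cder F (cconj z) l ->
  cder (fun u => cconj (F (cconj u))) z (cconj l).
Proof.
move=> [phi cphi [phil dphi]].
have cj : (fun u : C => cconj u) @ z --> cconj z by exact (at_conj (@cvg_id _ _)).
exists (fun u => cconj (phi (cconj u))); first exact (at_conj (at_comp cj cphi)).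
split; first by rewrite phil.
near=> u.
have E : F (cconj u) - F (cconj z) = phi (cconj u) * (cconj u - cconj z) by near: u; exact: (cj _ dphi).
by rewrite -cconjB E cconjM cconjB !cconjK.
Unshelve. all: by end_near. Qed.

Section Integral.
Variables (S : set C) (W : C -> C) (T : R).
Hypothesis So : metric_open S.
Hypothesis S_conj : forall z, S z -> S (cconj z).
Hypothesis S_shift : forall z y, S z -> S (z + ic * rc y).
Hypothesis dW : forall z, S z -> derivable W z 1.
Hypothesis T0 : 0 <= T.

(** The factor conj (W (conj z + i s)) is holomorphic in z, being doubly
    conjugated. *)
Lemma reflected_integral_derivable z0 : S z0 ->
  derivable (fun z => cint (fun s => W (z + ic * rc s) * cconj (W (cconj z + ic * rc s))) T) z0 1.
Proof.
move=> Sz0.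
have [W' dW' cW'] : exists2 W' : C -> C, forall z, S z -> cder W z (W' z) &
    forall z, S z -> W' @ z --> W' z.
  exists (derive1 W) => z Sz; first exact: derivable_cder (dW Sz).
  exact (derive1_continuous So dW Sz).
have cW z : S z -> W @ z --> W z by move=> /dW'; exact: cder_cvg.
pose k z s := W (z + ic * rc s) * cconj (W (cconj z + ic * rc s)).
pose k1 z s := W' (z + ic * rc s) * cconj (W (cconj z + ic * rc s)) +
               W (z + ic * rc s) * cconj (W' (cconj z + ic * rc s)).
have [r r0 Hr] := So Sz0.
have cis (s : R) : (fun s => ic * rc s) @ s --> ic * rc s.
  exact (atM (at_cst ic) (at_rc (@cvg_id _ _))).
have joint (H : C -> C) z (s : R) : (forall z, S z -> H @ z --> H z) -> S z ->
    (fun p : C * R => H (p.1 + ic * rc p.2)) @ (z, s) --> H (z + ic * rc s).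
  move=> cH Sz.
  have c1 : (fun p : C * R => p.1) @ (z, s) --> z by exact: cvg_fst.
  have c2 : (fun p : C * R => p.2) @ (z, s) --> s by exact: cvg_snd.
  exact (at_comp (atD c1 (at_comp c2 (cis s))) (cH _ (S_shift s Sz))).
have jointc (H : C -> C) z (s : R) : (forall z, S z -> H @ z --> H z) -> S z ->
    (fun p : C * R => cconj (H (cconj p.1 + ic * rc p.2))) @ (z, s) --> cconj (H (cconj z + ic * rc s)).
  move=> cH Sz.
  have c1 : (fun p : C * R => p.1) @ (z, s) --> z by exact: cvg_fst.
  have c2 : (fun p : C * R => p.2) @ (z, s) --> s by exact: cvg_snd.
  exact (at_conj (at_comp (atD (at_conj c1) (at_comp c2 (cis s))) (cH _ (S_shift s (S_conj Sz))))).
have slice (H : C * R -> C) z (s : R) l : H @ (z, s) --> l -> (fun s => H (z, s)) @ s --> l.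
  move=> cH; have c : (fun s : R => (z, s)) @ s --> (z, s).
    have cz : (fun _ : R => z) @ s --> z by exact (at_cst z).
    have cs : (fun s : R => s) @ s --> s by exact: cvg_id.
    exact (cvg_pair cz cs).
  exact (at_comp c cH).
have jk z s : S z -> (fun p : C * R => k p.1 p.2) @ (z, s) --> k z s.
  by move=> Sz; exact (atM (joint W z s cW Sz) (jointc W z s cW Sz)).
have jk1 z s : S z -> (fun p : C * R => k1 p.1 p.2) @ (z, s) --> k1 z s.
  move=> Sz; exact (atD (atM (joint W' z s cW' Sz) (jointc W z s cW Sz))
                        (atM (joint W z s cW Sz) (jointc W' z s cW' Sz))).
have nS : \forall z \near z0, S z by apply/nbhs_cmod; exists r.
suff d : cder (fun z => cint (k z) T) z0 (cint (k1 z0) T) by exact: (cder_derivable d).1.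
apply: (@cint_param_der R k k1 z0 T T0).
- apply: filterS nS => z Sz s; exact (slice _ z s _ (jk z s Sz)).
- move=> s; exact (slice _ z0 s _ (jk1 z0 s Sz0)).
- apply: filterS nS => z Sz s _.
  have d1 : cder (fun z => W (z + ic * rc s)) z (W' (z + ic * rc s) * (1 + 0)).
    exact (cder_comp (F := W) (f := fun z => z + ic * rc s)
      (dW' _ (S_shift s Sz)) (derD (cder_id z) (der_cst id (ic * rc s) z))).
  have d2 : cder (fun z => W (z + ic * rc s)) (cconj z) (W' (cconj z + ic * rc s) * (1 + 0)).
    exact (cder_comp (F := W) (f := fun z => z + ic * rc s)
      (dW' _ (S_shift s (S_conj Sz))) (derD (cder_id (cconj z)) (der_cst id (ic * rc s) (cconj z)))).
  rewrite addr0 mulr1 in d1; rewrite addr0 mulr1 in d2.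
  exact (cderM d1 (cder_conj (F := fun z => W (z + ic * rc s)) d2)).
- by move=> s _; exact: jk1.
Qed.

End Integral.
End Continuation.

Unset Implicit Arguments.

Theorem corollary2 (R : realType) (D U : set (Cplx R)) (f w : Cplx R -> Cplx R)
    (a b : \bar R)
    (hU : regular_lemniscate_region D U f a b)
    (hw : analytic_on U w) :
  exists L : Cplx R -> Cplx R,
    analytic_on (strip a b) L /\
    forall t : R, (a < t%:E < b)%E ->
      exists2 Lw : R,
        is_arclength_integral (level_set D f t `&` U)
          (fun z => cmod (w z) ^+ 2) Lw &
        L (real_complex R t) = real_complex R Lw.
Proof.
have [z0 Uz0] : exists z0, U z0.
  have [[_ _ _ [z0 Ez0 EU] _] _] := hU.
  by exists z0; rewrite EU; exact: connected_component_refl.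
have [[_ fz0] _ _ _ _] := U_band hU Uz0.
have [u0 fu0] := cexp_surj fz0; have Su0 := S_of_U hU Uz0 (esym fu0).
have [g lg _] := lift_through hU Su0 Uz0 (esym fu0).
have neS : exists z, strip a b z by exists u0.
have gsurj := lift_surj hU lg neS.
have [T T0 [gT ginj]] := lift_period hU lg neS.
have [h dh h2] := lift_sqrt hU lg neS.
have dg z : strip a b z -> derivable g z 1.
  by move=> Sz; exact: (cder_derivable (lift_cder hU lg Sz)).1.
pose W z := w (g z) * h z.
have dW z : strip a b z -> derivable W z 1.
  move=> Sz; have [Ug _ _] := lg _ Sz.
  have d1 := cder_comp (F := w) (f := g) (derivable_cder (hw _ Ug)) (derivable_cder (dg _ Sz)).
  exact: (cder_derivable (cderM d1 (derivable_cder (dh _ Sz)))).1.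
have Sc z : strip a b z -> strip a b (cconj z) by have := Re_cconj z; rewrite /strip /mkset => ->.
exists (fun z => cint (fun s => W (z + ic R * rc s) * cconj (W (cconj z + ic R * rc s))) T).
split.
  move=> z Sz.
  exact: (reflected_integral_derivable (@strip_open R a b) Sc (fun z y => @strip_shift R a b z y) dW (ltW T0) Sz).
move=> t tab; pose sqr_w z := cmod (w z) ^+ 2.
have hcont z : U z -> sqr_w @ z --> sqr_w z.
  move=> Uz; have c1 := at_cmod (cder_cvg (derivable_cder (hw _ Uz))).
  exact (cvgM c1 c1).
have [K dK] := antiderivative_exists (arclength_density_continuous hU lg tab hcont).
exists (K T - K 0); first exact: (level_arclength hU lg T0 gT ginj tab gsurj hcont dK).
have dE s : W (rc t + ic R * rc s) * cconj (W (rc t + ic R * rc s)) = rc (arclength_density f g t sqr_w s).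
  have Ss := S_pt tab s; have [_ g'E] := cder_derivable (lift_cder hU lg Ss).
  have hE : cmod (h (rc t + ic R * rc s)) ^+ 2 = cmod (level_velocity f g t s).
    rewrite -cmodX h2 // g'E -[LHS]mulr1 -(cmod_ic R) -cmodM; exact erefl.
  rewrite mul_conj /W cmodM exprMn hE; exact erefl.
have -> : cint (fun s => W (rc t + ic R * rc s) * cconj (W (cconj (rc t) + ic R * rc s))) T =
    cint (fun s => rc (arclength_density f g t sqr_w s)) T.
  have -> : cconj (rc t) = rc t by apply: complex_ext; rewrite ?Re_cconj ?Im_cconj /= ?oppr0.
  exact: cint_ext.
have cd : continuous (fun s => rc (arclength_density f g t sqr_w s)).
  by move=> s; exact (at_rc (@arclength_density_continuous R D U f a b hU g lg t tab sqr_w hcont s)).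
rewrite (cint_prim (ltW T0) cd (H := fun s => rc (K s))) -?rcB //.
by move=> s _; exact: rder_rc (dK s).
Qed.
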